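(* The set of finite TRSs $R$ that are strongly normalizing (i.e. strongly normalizing on every term) is $\Pi^0_2$-complete. Likewise, the set of finite TRSs that are weakly normalizing (on every term) is $\Pi^0_2$-complete.
   Context: All TRSs are finite sets of rules over a finite signature; terms may contain variables. A TRS $R$ is strongly normalizing on a term $t$ if every $\to_R$-rewrite sequence starting from $t$ is finite, and weakly normalizing on $t$ if $t\to_R^* s$ for some $\to_R$-normal form $s$. TRSs and terms are encoded as natural numbers by a standard effective Gödel numbering, and properties are identified with the corresponding sets of codes. $\Sigma^0_n,\Pi^0_n$ are the classes of the arithmetical hierarchy; a set $B$ is $\mathcal P$-complete if $B\in\mathcal P$ and every $A\in\mathcal P$ is many-one reducible to $B$ via a total computable function. *)

(* Defs.v *)
From Stdlib Require Import List Arith Relations.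
Import ListNotations.

(*    Arguments beyond the arity actually used are ignored.            *)

Inductive prcode : Type :=
| cZero : prcode
| cSucc : prcode
| cProj : nat -> prcode
| cComp : prcode -> list prcode -> prcode
| cRec  : prcode -> prcode -> prcode
| cMu   : prcode -> prcode.

Inductive eval : prcode -> list nat -> nat -> Prop :=
| ev_zero v : eval cZero v 0
| ev_succ v : eval cSucc v (S (hd 0 v))
| ev_proj i v : eval (cProj i) v (nth i v 0)
| ev_comp f gs v ws y :
    evalL gs v ws -> eval f ws y -> eval (cComp f gs) v y
| ev_rec0 f g v y :
    eval f v y -> eval (cRec f g) (0 :: v) y
| ev_recS f g n v y z :
    eval (cRec f g) (n :: v) y -> eval g (n :: y :: v) z ->
    eval (cRec f g) (S n :: v) z
| ev_mu f v n :
    eval f (n :: v) 0 ->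
    (forall m, m < n -> exists k, eval f (m :: v) (S k)) ->
    eval (cMu f) v n
with evalL : list prcode -> list nat -> list nat -> Prop :=
| evL_nil v : evalL [] v []
| evL_cons g gs v w ws : eval g v w -> evalL gs v ws -> evalL (g :: gs) v (w :: ws).

Definition computable (f : nat -> nat) : Prop :=
  exists c, forall x, eval c [x] (f x).

Definition recursive_rel (A : list nat -> Prop) : Prop :=
  exists c, forall v, (A v -> eval c v 0) /\ (~ A v -> eval c v 1).

Fixpoint SigmaRel (n : nat) (A : list nat -> Prop) : Prop :=
  match n with
  | 0 => recursive_rel A
  | S m => exists B, PiRel m B /\ forall v, A v <-> exists y, B (y :: v)
  end
with PiRel (n : nat) (A : list nat -> Prop) : Prop :=
  match n with
  | 0 => recursive_rel A
  | S m => exists B, SigmaRel m B /\ forall v, A v <-> forall y, B (y :: v)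
  end.

Definition in_Sigma (n : nat) (A : nat -> Prop) : Prop :=
  SigmaRel n (fun v => A (hd 0 v)).
Definition in_Pi (n : nat) (A : nat -> Prop) : Prop :=
  PiRel n (fun v => A (hd 0 v)).

Definition many_one_reducible (B A : nat -> Prop) : Prop :=
  exists f, computable f /\ forall x, B x <-> A (f x).

Definition Pi_complete (n : nat) (A : nat -> Prop) : Prop :=
  in_Pi n A /\ forall B, in_Pi n B -> many_one_reducible B A.

(*    A function symbol is a name f : nat; a signature is a finite list *)
(*    of (name, arity) pairs.  Variables are indexed by nat.            *)

Inductive term : Type :=
| Var : nat -> term
| Fun : nat -> list term -> term.

Fixpoint subst (s : nat -> term) (t : term) : term :=
  match t with
  | Var x => s x
  | Fun f ts => Fun f (map (subst s) ts)
  end.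

Fixpoint vars (t : term) : list nat :=
  match t with
  | Var x => [x]
  | Fun _ ts => flat_map vars ts
  end.

Definition signature := list (nat * nat).

Inductive term_over (sg : signature) : term -> Prop :=
| to_var x : term_over sg (Var x)
| to_fun f ts :
    In (f, length ts) sg -> (forall u, In u ts -> term_over sg u) ->
    term_over sg (Fun f ts).

Record trs : Type := mkTRS {
  trs_sig : signature;
  trs_rules : list (term * term)
}.

Definition wf_trs (R : trs) : Prop :=
  forall l r, In (l, r) (trs_rules R) ->
    term_over (trs_sig R) l /\ term_over (trs_sig R) r /\
    (forall x, l <> Var x) /\
    (forall x, In x (vars r) -> In x (vars l)).

Inductive step (R : trs) : term -> term -> Prop :=
| step_root l r s :
    In (l, r) (trs_rules R) -> step R (subst s l) (subst s r)
| step_ctx f pre t t' post :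
    step R t t' ->
    step R (Fun f (pre ++ t :: post)) (Fun f (pre ++ t' :: post)).

Definition normal_form (R : trs) (t : term) : Prop :=
  ~ exists u, step R t u.

Definition SN_on (R : trs) (t : term) : Prop :=
  ~ exists seq : nat -> term,
      seq 0 = t /\ forall i, step R (seq i) (seq (S i)).

Definition WN_on (R : trs) (t : term) : Prop :=
  exists s, clos_refl_trans term (step R) t s /\ normal_form R s.

Definition strongly_normalizing (R : trs) : Prop :=
  forall t, term_over (trs_sig R) t -> SN_on R t.

Definition weakly_normalizing (R : trs) : Prop :=
  forall t, term_over (trs_sig R) t -> WN_on R t.

Definition cpair (x y : nat) : nat := (x + y) * (x + y + 1) / 2 + y.

Fixpoint enc_list (l : list nat) : nat :=
  match l with
  | [] => 0
  | x :: l' => S (cpair x (enc_list l'))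
  end.

Fixpoint enc_term (t : term) : nat :=
  match t with
  | Var x => cpair 0 x
  | Fun f ts => cpair (S f) (enc_list (map enc_term ts))
  end.

Definition enc_trs (R : trs) : nat :=
  cpair (enc_list (map (fun p => cpair (fst p) (snd p)) (trs_sig R)))
        (enc_list (map (fun lr => cpair (enc_term (fst lr)) (enc_term (snd lr)))
                       (trs_rules R))).

Definition SN_codes (n : nat) : Prop :=
  exists R, wf_trs R /\ enc_trs R = n /\ strongly_normalizing R.

Definition WN_codes (n : nat) : Prop :=
  exists R, wf_trs R /\ enc_trs R = n /\ weakly_normalizing R.

(* Main.v *)
(* Membership: every natural number codes a unique term and a unique TRS, so the
   list of all [k]-step reducts of a term is a computable function of the codes.
   By König's lemma a term [t] is strongly normalizing iff for some [k] this list
   is empty, and it is weakly normalizing iff for some [k] it contains a normal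
   form; well-formedness is decidable, so both sets are of the form
   "for all [t] there is [k]".

   Hardness: let B(n) hold iff for all y there is z with B0(z,y,n), B0 decided by
   a program p.  A stack machine that evaluates programs is turned into a TRS by
   equipping its states with a clock: [tClock (S k) s] rewrites to [tClock k s']
   when s' is the successor state of s, and [tClock 0 s] to [tGo].  The search rule
     tRun y w tGo -> tRun y (S w) (tClock w (tInit y 0))
   raises the time limit until the evaluation of "least z with B0(z,y,n)" is seen
   to halt.  If B(n) fails at y, no reduct of [tRun y 0 tGo] is a normal form.  If
   B(n) holds, all terms are strongly normalizing, including the meaningless ones:
   evaluating [tClock] by actually running the machine yields a model of the rules
   on the set of all terms, and the search symbol, labelled with the time that
   remains until the machine started on the value of y halts, decreases. *)

From Stdlib Require Import List Arith Lia Bool Classical IndefiniteDescription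
  Relations Wellfounded.
Require Import Defs.
Import ListNotations.

(** * Recursive functions on numbers *)

(** The argument list is left arbitrary, as in [recursive_rel]; missing arguments read as 0, both in
    [nth] and in [cProj]. *)
Definition cmp (F : list nat -> nat) : Prop := exists c, forall v, eval c v (F v).
Definition cmp1 (g : nat -> nat) : Prop := cmp (fun v => g (nth 0 v 0)).
Definition cmp2 (g : nat -> nat -> nat) : Prop :=
  cmp (fun v => g (nth 0 v 0) (nth 1 v 0)).
Definition cmp3 (g : nat -> nat -> nat -> nat) : Prop :=
  cmp (fun v => g (nth 0 v 0) (nth 1 v 0) (nth 2 v 0)).

Lemma cmp_ext F G : (forall v, F v = G v) -> cmp F -> cmp G.
Proof. intros E [c H]; exists c; intro v; rewrite <- E; apply H. Qed.

Lemma cmp_proj i : cmp (fun v => nth i v 0).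
Proof. exists (cProj i); intro v; apply ev_proj. Qed.

Lemma cmp_comp1 g a : cmp1 g -> cmp a -> cmp (fun v => g (a v)).
Proof.
  intros [c H] [ca Ha]; exists (cComp c [ca]); intro v.
  apply ev_comp with (ws := [a v]); [|apply (H [a v])].
  repeat constructor; apply Ha.
Qed.

Lemma cmp_comp2 g a b : cmp2 g -> cmp a -> cmp b -> cmp (fun v => g (a v) (b v)).
Proof.
  intros [c H] [ca Ha] [cb Hb]; exists (cComp c [ca; cb]); intro v.
  apply ev_comp with (ws := [a v; b v]); [|apply (H [a v; b v])].
  repeat constructor; auto.
Qed.

Lemma cmp1_S : cmp1 S.
Proof.
  exists cSucc; intro v; destruct v; [exact (ev_succ [])|exact (ev_succ (n :: v))].
Qed.

Lemma cmp_const k : cmp (fun _ => k).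
Proof.
  induction k as [|k IH]; [exists cZero; intro; constructor|].
  exact (cmp_comp1 S _ cmp1_S IH).
Qed.

Lemma cmp2_rec b s : cmp1 b -> cmp3 s ->
  cmp2 (fun n x => nat_rect (fun _ => nat) (b x) (fun k y => s k y x) n).
Proof.
  intros [cb Hb] [cs Hs].
  (* The projections cut the list down to exactly two arguments, so that the base case runs on [[x]]
     and the step on [[k; y; x]]. *)
  exists (cComp (cRec cb cs) [cProj 0; cProj 1]); intro v.
  apply ev_comp with (ws := [nth 0 v 0; nth 1 v 0]);
    [repeat constructor|].
  generalize (nth 0 v 0) (nth 1 v 0); intros n x.
  induction n as [|n IH]; cbn.
  - apply ev_rec0, (Hb [x]).
  - eapply ev_recS; [exact IH|apply (Hs [_; _; _])].
Qed.

Lemma cmp2_swap g : cmp2 g -> cmp2 (fun x y => g y x).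
Proof. intro H; exact (cmp_comp2 g _ _ H (cmp_proj 1) (cmp_proj 0)). Qed.

Lemma cmp2_add : cmp2 Nat.add.
Proof.
  eapply cmp_ext;
    [|apply (cmp2_rec (fun x => x) (fun _ y _ => S y));
      [apply (cmp_proj 0)|apply (cmp_comp1 S _ cmp1_S (cmp_proj 1))]].
  intro v; cbv beta; generalize (nth 0 v 0) (nth 1 v 0); intros n x.
  induction n; cbn; congruence.
Qed.

Lemma cmp2_mul : cmp2 Nat.mul.
Proof.
  eapply cmp_ext;
    [|apply (cmp2_rec (fun _ => 0) (fun _ y x => x + y));
      [exact (cmp_const 0)|apply (cmp_comp2 _ _ _ cmp2_add (cmp_proj 2) (cmp_proj 1))]].
  intro v; cbv beta; generalize (nth 0 v 0) (nth 1 v 0); intros n x.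
  induction n; cbn; congruence.
Qed.

Lemma cmp1_pred : cmp1 Nat.pred.
Proof.
  assert (H : cmp2 (fun n x => nat_rect (fun _ => nat) 0 (fun k y => k) n))
    by (apply (cmp2_rec (fun _ => 0) (fun k _ _ => k));
        [exact (cmp_const 0)|apply (cmp_proj 0)]).
  eapply cmp_ext; [|exact (cmp_comp2 _ _ _ H (cmp_proj 0) (cmp_proj 0))].
  intro v; cbv beta; destruct (nth 0 v 0); reflexivity.
Qed.

Lemma cmp2_sub : cmp2 Nat.sub.
Proof.
  (* The recursion iterates the predecessor, so the subtrahend has to come first. *)
  apply (cmp2_swap (fun n x => x - n)).
  eapply cmp_ext;
    [|apply (cmp2_rec (fun x => x) (fun _ y _ => Nat.pred y));
      [apply (cmp_proj 0)|apply (cmp_comp1 _ _ cmp1_pred (cmp_proj 1))]].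
  intro v; cbv beta; generalize (nth 0 v 0) (nth 1 v 0); intros n x.
  induction n as [|n IH]; cbn; [|rewrite IH]; lia.
Qed.

Definition ifz (b x y : nat) : nat := match b with 0 => x | S _ => y end.

(** With truncated subtraction, [1 - b] and [1 - (1 - b)] are the indicators of [b = 0] and of
    [b <> 0]; each branch is multiplied by its indicator. *)
Lemma cmp_ifz b x y : cmp b -> cmp x -> cmp y ->
  cmp (fun v => ifz (b v) (x v) (y v)).
Proof.
  intros Hb Hx Hy.
  pose proof (cmp_comp2 _ _ _ cmp2_sub (cmp_const 1) Hb) as H1.
  pose proof (cmp_comp2 _ _ _ cmp2_sub (cmp_const 1) H1) as H2.
  eapply cmp_ext;
    [|exact (cmp_comp2 _ _ _ cmp2_add (cmp_comp2 _ _ _ cmp2_mul H1 Hx)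
               (cmp_comp2 _ _ _ cmp2_mul H2 Hy))].
  intro v; cbv beta; unfold ifz; destruct (b v); simpl; lia.
Qed.

(** * Cantor pairing and its inverse *)

Fixpoint tri (n : nat) : nat := match n with 0 => 0 | S m => tri m + S m end.

Lemma tri_half n : n * (n + 1) / 2 = tri n.
Proof.
  induction n as [|n IH]; [reflexivity|]; simpl tri; rewrite <- IH.
  replace (S n * (S n + 1)) with (n * (n + 1) + S n * 2) by lia.
  now rewrite Nat.div_add by lia.
Qed.

Lemma cpair_tri x y : cpair x y = tri (x + y) + y.
Proof. unfold cpair; now rewrite tri_half. Qed.

Lemma cmp1_tri : cmp1 tri.
Proof.
  assert (H : cmp2 (fun n x => nat_rect (fun _ => nat) 0 (fun k y => y + S k) n)).
  { apply (cmp2_rec (fun _ => 0) (fun k y _ => y + S k)); [exact (cmp_const 0)|].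
    exact (cmp_comp2 _ _ _ cmp2_add (cmp_proj 1) (cmp_comp1 _ _ cmp1_S (cmp_proj 0))). }
  eapply cmp_ext; [|exact (cmp_comp2 _ _ _ H (cmp_proj 0) (cmp_proj 0))].
  intro v; cbv beta; induction (nth 0 v 0); cbn in *; congruence.
Qed.

Lemma cmp2_cpair : cmp2 cpair.
Proof.
  eapply cmp_ext; [intro v; symmetry; apply cpair_tri|].
  apply (cmp_comp2 _ _ _ cmp2_add); [|apply cmp_proj].
  apply (cmp_comp1 _ _ cmp1_tri), (cmp_comp2 _ _ _ cmp2_add); apply cmp_proj.
Qed.

(* The antidiagonal containing [n]: the largest [w] with [tri w <= n]. *)
Definition diag (n : nat) : nat :=
  nat_rect (fun _ => nat) 0 (fun k w => ifz (tri (S w) - S k) (S w) w) n.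

Lemma tri_mono x y : x <= y -> tri x <= tri y.
Proof. induction 1; simpl; lia. Qed.

Lemma diag_spec n : tri (diag n) <= n < tri (S (diag n)).
Proof.
  induction n as [|n IH]; [cbn; lia|].
  change (diag (S n)) with (ifz (tri (S (diag n)) - S n) (S (diag n)) (diag n)).
  destruct (tri (S (diag n)) - S n) eqn:E; simpl ifz; simpl tri in *; lia.
Qed.

Lemma diag_unique n w : tri w <= n < tri (S w) -> diag n = w.
Proof.
  intro H; pose proof (diag_spec n) as D.
  destruct (lt_eq_lt_dec (diag n) w) as [[L|E]|L]; [|exact E|].
  - pose proof (tri_mono (S (diag n)) w L); lia.
  - pose proof (tri_mono (S w) (diag n) L); lia.
Qed.

Definition unp2 (n : nat) : nat := n - tri (diag n).
Definition unp1 (n : nat) : nat := diag n - unp2 n.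

Lemma diag_cpair x y : diag (cpair x y) = x + y.
Proof. apply diag_unique; rewrite cpair_tri; simpl; lia. Qed.

Lemma unp2_cpair x y : unp2 (cpair x y) = y.
Proof. unfold unp2; rewrite diag_cpair, cpair_tri; lia. Qed.

Lemma unp1_cpair x y : unp1 (cpair x y) = x.
Proof. unfold unp1; rewrite unp2_cpair, diag_cpair; lia. Qed.

Lemma cpair_unp n : cpair (unp1 n) (unp2 n) = n.
Proof.
  rewrite cpair_tri; unfold unp1, unp2; pose proof (diag_spec n); simpl tri in *.
  replace (diag n - (n - tri (diag n)) + (n - tri (diag n))) with (diag n); lia.
Qed.

Lemma cpair_inj x y x' y' : cpair x y = cpair x' y' -> x = x' /\ y = y'.
Proof.
  intro E; split; [rewrite <- (unp1_cpair x y), E|rewrite <- (unp2_cpair x y), E];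
    [apply unp1_cpair|apply unp2_cpair].
Qed.

Lemma cpair_ge_fst x y : x <= cpair x y.
Proof.
  rewrite cpair_tri; enough (x + y <= tri (x + y)) by lia.
  induction (x + y); simpl; lia.
Qed.

Lemma cpair_ge_snd x y : y <= cpair x y.
Proof. rewrite cpair_tri; lia. Qed.

Lemma cmp1_diag : cmp1 diag.
Proof.
  assert (H : cmp2 (fun n x =>
    nat_rect (fun _ => nat) 0 (fun k w => ifz (tri (S w) - S k) (S w) w) n)).
  { apply (cmp2_rec (fun _ => 0) (fun k w _ => ifz (tri (S w) - S k) (S w) w));
      [exact (cmp_const 0)|].
    pose proof (cmp_comp1 _ _ cmp1_S (cmp_proj 1)) as HS.
    apply cmp_ifz; [|exact HS|apply cmp_proj].
    exact (cmp_comp2 _ _ _ cmp2_sub (cmp_comp1 _ _ cmp1_tri HS)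
             (cmp_comp1 _ _ cmp1_S (cmp_proj 0))). }
  exact (cmp_comp2 _ _ _ H (cmp_proj 0) (cmp_proj 0)).
Qed.

Lemma cmp1_unp2 : cmp1 unp2.
Proof.
  exact (cmp_comp2 _ _ _ cmp2_sub (cmp_proj 0)
           (cmp_comp1 _ _ cmp1_tri (cmp_comp1 _ _ cmp1_diag (cmp_proj 0)))).
Qed.

Lemma cmp1_unp1 : cmp1 unp1.
Proof.
  exact (cmp_comp2 _ _ _ cmp2_sub (cmp_comp1 _ _ cmp1_diag (cmp_proj 0))
           (cmp_comp1 _ _ cmp1_unp2 (cmp_proj 0))).
Qed.

(** * Computable functions on coded data *)

Class Enc (A : Type) := enc : A -> nat.

#[export] Instance Enc_nat : Enc nat := fun n => n.
(* [true] is coded by 0, the value by which [recursive_rel] signals membership. *)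
#[export] Instance Enc_bool : Enc bool := fun b => if b then 0 else 1.
#[export] Instance Enc_prod A B `{Enc A} `{Enc B} : Enc (A * B) :=
  fun p => cpair (enc (fst p)) (enc (snd p)).
#[export] Instance Enc_list A `{Enc A} : Enc (list A) := fun l => enc_list (map enc l).
#[export] Instance Enc_term : Enc term := enc_term.

(* The realizer [g] is total, also on numbers that code nothing, so that it can
   be iterated by [cRec] on arbitrary numbers. *)
Definition Comp {A B} `{Enc A} `{Enc B} (f : A -> B) : Prop :=
  exists g, cmp1 g /\ forall a, g (enc a) = enc (f a).

Section Combinators.
Context {A B C X : Type} `{Enc A} `{Enc B} `{Enc C} `{Enc X}.

Lemma Comp_ext (f g : A -> B) : (forall a, f a = g a) -> Comp f -> Comp g.
Proof. intros E [h [Hh Hf]]; exists h; split; [|intro a; rewrite <- E]; auto. Qed.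

Lemma Comp_id : Comp (fun a : A => a).
Proof. exists (fun n => n); split; [apply (cmp_proj 0)|reflexivity]. Qed.

Lemma Comp_const (b : B) : Comp (fun _ : A => b).
Proof. exists (fun _ => enc b); split; [exact (cmp_const _)|reflexivity]. Qed.

Lemma Comp_compose (f : B -> C) (g : A -> B) :
  Comp f -> Comp g -> Comp (fun a => f (g a)).
Proof.
  intros [f' [Cf Hf]] [g' [Cg Hg]]; exists (fun n => f' (g' n)); split.
  - exact (cmp_comp1 _ _ Cf Cg).
  - intro a; now rewrite Hg, Hf.
Qed.

Lemma Comp_pair (f : A -> B) (g : A -> C) :
  Comp f -> Comp g -> Comp (fun a => (f a, g a)).
Proof.
  intros [f' [Cf Hf]] [g' [Cg Hg]]; exists (fun n => cpair (f' n) (g' n)); split.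
  - exact (cmp_comp2 _ _ _ cmp2_cpair Cf Cg).
  - intro a; now rewrite Hg, Hf.
Qed.

Lemma Comp_fst (f : A -> B * C) : Comp f -> Comp (fun a => fst (f a)).
Proof.
  intros [f' [Cf Hf]]; exists (fun n => unp1 (f' n)); split.
  - exact (cmp_comp1 _ _ cmp1_unp1 Cf).
  - intro a; rewrite Hf; apply unp1_cpair.
Qed.

Lemma Comp_snd (f : A -> B * C) : Comp f -> Comp (fun a => snd (f a)).
Proof.
  intros [f' [Cf Hf]]; exists (fun n => unp2 (f' n)); split.
  - exact (cmp_comp1 _ _ cmp1_unp2 Cf).
  - intro a; rewrite Hf; apply unp2_cpair.
Qed.

(** Numbers code themselves, so passing from a datum to its code costs nothing. This supplies bounds
    for recursions and reduces equality of terms to equality of numbers. *)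
Lemma Comp_enc (f : A -> B) : Comp f -> Comp (fun a => enc (f a)).
Proof. intros [g [Cg Hg]]; now exists g. Qed.

Lemma Comp_S (f : A -> nat) : Comp f -> Comp (fun a => S (f a)).
Proof.
  intros [g [Cg Hg]]; exists (fun n => S (g n)); split.
  - exact (cmp_comp1 _ _ cmp1_S Cg).
  - intro a; now rewrite Hg.
Qed.

(** The sum of the two truncated differences vanishes exactly when the arguments agree. *)
Lemma Comp_eqb (f g : A -> nat) : Comp f -> Comp g -> Comp (fun a => f a =? g a).
Proof.
  intros [f' [Cf Hf]] [g' [Cg Hg]].
  exists (fun n => ifz ((f' n - g' n) + (g' n - f' n)) 0 1); split.
  - apply (cmp_ifz (fun v => (_ - _) + (_ - _)) (fun _ => 0) (fun _ => 1));
      [|exact (cmp_const 0)|exact (cmp_const 1)].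
    apply (cmp_comp2 _ _ _ cmp2_add); apply (cmp_comp2 _ _ _ cmp2_sub);
      assumption.
  - intro a; rewrite Hf, Hg; unfold enc, Enc_nat, Enc_bool.
    destruct (Nat.eqb_spec (f a) (g a)) as [->|N].
    + now rewrite Nat.sub_diag.
    + destruct (f a - g a + (g a - f a)) eqn:E; [lia|reflexivity].
Qed.

Lemma Comp_if (b : A -> bool) (f g : A -> B) :
  Comp b -> Comp f -> Comp g -> Comp (fun a => if b a then f a else g a).
Proof.
  intros [b' [Cb Hb]] [f' [Cf Hf]] [g' [Cg Hg]].
  exists (fun n => ifz (b' n) (f' n) (g' n)); split.
  - exact (cmp_ifz _ _ _ Cb Cf Cg).
  - intro a; rewrite Hb, Hf, Hg; now destruct (b a).
Qed.

Lemma Comp_nat_rect (n : A -> nat) (b : A -> B) (s : A -> nat -> B -> B) :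
  Comp n -> Comp b ->
  Comp (fun p : A * (nat * B) => s (fst p) (fst (snd p)) (snd (snd p))) ->
  Comp (fun a => nat_rect (fun _ => B) (b a) (s a) (n a)).
Proof.
  intros [n' [Cn Hn]] [b' [Cb Hb]] [s' [Cs Hs]].
  exists (fun x => nat_rect (fun _ => nat) (b' x)
                     (fun k y => s' (cpair x (cpair k y))) (n' x)); split.
  - assert (R := cmp2_rec b' (fun k y x => s' (cpair x (cpair k y))) Cb).
    refine (cmp_comp2 _ _ _ (R _) Cn (cmp_proj 0)).
    apply (cmp_comp1 _ _ Cs), (cmp_comp2 _ _ _ cmp2_cpair (cmp_proj 2)).
    exact (cmp_comp2 _ _ _ cmp2_cpair (cmp_proj 0) (cmp_proj 1)).
  - intro a; rewrite Hn; change (enc (n a)) with (n a).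
    induction (n a) as [|k IH]; simpl; [apply Hb|].
    rewrite IH; exact (Hs (a, (k, _))).
Qed.

Lemma Comp_nil : Comp (fun _ : A => @nil X).
Proof. exists (fun _ => 0); split; [exact (cmp_const 0)|reflexivity]. Qed.

Lemma Comp_cons (f : A -> X) (l : A -> list X) :
  Comp f -> Comp l -> Comp (fun a => f a :: l a).
Proof.
  intros [f' [Cf Hf]] [l' [Cl Hl]]; exists (fun n => S (cpair (f' n) (l' n))); split.
  - exact (cmp_comp1 _ _ cmp1_S (cmp_comp2 _ _ _ cmp2_cpair Cf Cl)).
  - intro a; now rewrite Hf, Hl.
Qed.

(** The empty list has code 0, and the predecessor of any other code is the pair of head and
    tail. *)
Lemma Comp_list_case (l : A -> list X) (d : A -> B) (s : A -> X -> list X -> B) :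
  Comp l -> Comp d ->
  Comp (fun p : A * (X * list X) => s (fst p) (fst (snd p)) (snd (snd p))) ->
  Comp (fun a => match l a with [] => d a | x :: r => s a x r end).
Proof.
  intros [l' [Cl Hl]] [d' [Cd Hd]] [s' [Cs Hs]].
  exists (fun n => ifz (l' n) (d' n) (s' (cpair n (pred (l' n))))); split.
  - apply cmp_ifz; [exact Cl|exact Cd|].
    apply (cmp_comp1 _ _ Cs), (cmp_comp2 _ _ _ cmp2_cpair (cmp_proj 0)).
    exact (cmp_comp1 _ _ cmp1_pred Cl).
  - intro a; rewrite Hl; destruct (l a) as [|x r]; simpl; [apply Hd|].
    exact (Hs (a, (x, r))).
Qed.
End Combinators.

Lemma enc_list_length (l : list nat) : length l <= enc_list l.
Proof.
  induction l as [|x l IH]; simpl; [lia|].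
  pose proof (cpair_ge_snd x (enc_list l)); lia.
Qed.

Section Folds.
Context {A B X Y : Type} `{Enc A} `{Enc B} `{Enc X} `{Enc Y}.

(** The fold becomes an iteration on pairs of remaining list and accumulator. The code of the list
    bounds its length, and surplus rounds change nothing once the list is exhausted. *)
Lemma Comp_fold_left (l : A -> list X) (b : A -> B) (s : A -> B -> X -> B) :
  Comp l -> Comp b ->
  Comp (fun p : A * (B * X) => s (fst p) (fst (snd p)) (snd (snd p))) ->
  Comp (fun a => fold_left (s a) (l a) (b a)).
Proof.
  intros Cl Cb Cs.
  set (st := fun a (q : list X * B) =>
    match fst q with [] => q | x :: r => (r, s a (snd q) x) end).
  assert (E : forall a n q, length (fst q) <= n ->
    snd (nat_rect (fun _ => (list X * B)%type) q (fun _ => st a) n)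
    = fold_left (s a) (fst q) (snd q)).
  { intros a n q L.
    (* [nat_rect] performs the new round last; the induction needs it first. *)
    assert (G : forall m, nat_rect (fun _ => (list X * B)%type) q (fun _ => st a) (S m)
      = nat_rect (fun _ => (list X * B)%type) (st a q) (fun _ => st a) m)
      by (induction m; simpl in *; congruence).
    revert q L G; induction n as [|n IH]; intros [l0 b0] L G.
    - destruct l0; simpl in *; [reflexivity|lia].
    - rewrite G, IH.
      + destruct l0; reflexivity.
      + destruct l0; simpl in *; lia.
      + clear; intro m; induction m; simpl in *; congruence. }
  apply Comp_ext with (f := fun a =>
    snd (nat_rect (fun _ => (list X * B)%type) (l a, b a) (fun _ => st a) (enc (l a)))).
  - intro a; apply (E a _ (l a, b a)); unfold enc, Enc_list; simpl.
    rewrite <- (length_map enc (l a)); apply enc_list_length.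
  - apply Comp_snd, Comp_nat_rect.
    + now apply Comp_enc.
    + now apply Comp_pair.
    + unfold st; apply (Comp_list_case (fun p => fst (snd (snd p)))
        (fun p => snd (snd p)) (fun p x r => (r, s (fst p) (snd (snd (snd p))) x))).
      * repeat first [apply Comp_fst | apply Comp_snd]; apply Comp_id.
      * repeat first [apply Comp_fst | apply Comp_snd]; apply Comp_id.
      * apply Comp_pair;
          [repeat first [apply Comp_fst | apply Comp_snd]; apply Comp_id|].
        apply (Comp_compose (fun p : A * (B * X) => s (fst p) (fst (snd p)) (snd (snd p)))
          (fun q : (A * (nat * (list X * B))) * (X * list X) =>
             (fst (fst q), (snd (snd (snd (fst q))), fst (snd q)))) Cs).
        repeat apply Comp_pair;
          repeat first [apply Comp_fst | apply Comp_snd]; apply Comp_id.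
Qed.

Lemma Comp_compose2 (f : A -> B -> Y) (g : X -> A) (h : X -> B) :
  Comp (fun p : A * B => f (fst p) (snd p)) -> Comp g -> Comp h ->
  Comp (fun x => f (g x) (h x)).
Proof.
  intros Cf Cg Ch.
  exact (Comp_compose _ (fun x => (g x, h x)) Cf (Comp_pair _ _ Cg Ch)).
Qed.
End Folds.

(** A right fold is a left fold over the reversed list, and reversal is itself a left fold. *)
Lemma Comp_fold_right {A B X} `{Enc A} `{Enc B} `{Enc X}
  (l : A -> list X) (b : A -> B) (s : A -> X -> B -> B) :
  Comp l -> Comp b ->
  Comp (fun p : A * (X * B) => s (fst p) (fst (snd p)) (snd (snd p))) ->
  Comp (fun a => fold_right (s a) (b a) (l a)).
Proof.
  intros Cl Cb Cs.
  apply Comp_ext with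
    (f := fun a => fold_left (fun y x => s a x y)
            (fold_left (fun r x => x :: r) (l a) []) (b a)).
  - intro a.
    assert (E : forall l0 r, fold_left (fun r (x : X) => x :: r) l0 r = rev l0 ++ r).
    { induction l0 as [|x l0 IH]; intro r; simpl; [reflexivity|].
      now rewrite IH, <- app_assoc. }
    now rewrite E, app_nil_r, <- fold_left_rev_right, rev_involutive.
  - apply Comp_fold_left; [apply Comp_fold_left|assumption|];
      [assumption|apply Comp_nil| |].
    + apply Comp_cons; repeat first [apply Comp_fst | apply Comp_snd]; apply Comp_id.
    + apply (Comp_compose _ (fun p => (fst p, (snd (snd p), fst (snd p)))) Cs).
      repeat apply Comp_pair;
        repeat first [apply Comp_fst | apply Comp_snd]; apply Comp_id.
Qed.

Ltac comp :=
  repeat (first [ assumption | lazymatch goal with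
  | |- Comp (fun _ => []) => apply Comp_nil
  | |- Comp (fun _ => ?b) => apply Comp_const
  | |- Comp (fun a => a) => apply Comp_id
  | |- Comp (fun a => (_, _)) => apply Comp_pair
  | |- Comp fst => apply (Comp_fst (fun p => p))
  | |- Comp snd => apply (Comp_snd (fun p => p))
  | |- Comp (fun a => fst _) => apply Comp_fst
  | |- Comp (fun a => snd _) => apply Comp_snd
  | |- Comp (fun a => _ :: _) => apply Comp_cons
  | |- Comp (fun a => S _) => apply Comp_S
  | |- Comp (fun a => _ =? _) => apply Comp_eqb
  | |- Comp (fun a => if _ then _ else _) => apply Comp_if
  end ]).

Section Lists.
Context {A X Y : Type} `{Enc A} `{Enc X} `{Enc Y}.

Lemma Comp_map (f : A -> X -> Y) (l : A -> list X) :
  Comp (fun p : A * X => f (fst p) (snd p)) -> Comp l ->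
  Comp (fun a => map (f a) (l a)).
Proof.
  intros Cf Cl.
  apply Comp_ext with (f := fun a => fold_right (fun x r => f a x :: r) [] (l a)).
  - intro a; induction (l a); simpl; congruence.
  - apply Comp_fold_right; comp; apply (Comp_compose2 f); comp.
Qed.

Lemma Comp_app (l r : A -> list X) : Comp l -> Comp r -> Comp (fun a => l a ++ r a).
Proof.
  intros Cl Cr.
  apply Comp_ext with (f := fun a => fold_right cons (r a) (l a)).
  - intro a; induction (l a); simpl; congruence.
  - apply (Comp_fold_right l r (fun _ => cons)); comp.
Qed.

Lemma Comp_existsb (f : A -> X -> bool) (l : A -> list X) :
  Comp (fun p : A * X => f (fst p) (snd p)) -> Comp l ->
  Comp (fun a => existsb (f a) (l a)).
Proof.
  intros Cf Cl.
  apply Comp_ext with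
    (f := fun a => fold_right (fun x (r : bool) => if f a x then true else r) false (l a)).
  - intro a; induction (l a); simpl; [|destruct (f a a0)]; simpl; congruence.
  - apply Comp_fold_right; comp; apply (Comp_compose2 f); comp.
Qed.

Lemma Comp_forallb (f : A -> X -> bool) (l : A -> list X) :
  Comp (fun p : A * X => f (fst p) (snd p)) -> Comp l ->
  Comp (fun a => forallb (f a) (l a)).
Proof.
  intros Cf Cl.
  apply Comp_ext with
    (f := fun a => fold_right (fun x (r : bool) => if f a x then r else false) true (l a)).
  - intro a; induction (l a); simpl; [|destruct (f a a0)]; simpl; congruence.
  - apply Comp_fold_right; comp; apply (Comp_compose2 f); comp.
Qed.

Lemma Comp_length (l : A -> list X) : Comp l -> Comp (fun a => length (l a)).
Proof.
  intro Cl.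
  apply Comp_ext with (f := fun a => fold_right (fun _ => S) 0 (l a)).
  - intro a; induction (l a); simpl; congruence.
  - apply (Comp_fold_right l (fun _ => 0) (fun _ _ => S)); comp.
Qed.
End Lists.

Lemma Comp_flat_map {A X Y} `{Enc A} `{Enc X} `{Enc Y}
  (f : A -> X -> list Y) (l : A -> list X) :
  Comp (fun p : A * X => f (fst p) (snd p)) -> Comp l ->
  Comp (fun a => flat_map (f a) (l a)).
Proof.
  intros Cf Cl.
  apply Comp_ext with (f := fun a => fold_right (fun x r => f a x ++ r) [] (l a)).
  - intro a; induction (l a); simpl; congruence.
  - apply Comp_fold_right; comp; apply Comp_app; comp; apply (Comp_compose2 f); comp.
Qed.

Lemma Comp_andb {A} `{Enc A} (b c : A -> bool) :
  Comp b -> Comp c -> Comp (fun a => b a && c a).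
Proof.
  intros Hb Hc; apply Comp_ext with (f := fun a => if b a then c a else false).
  - intro a; now destruct (b a).
  - comp.
Qed.

Lemma Comp_orb {A} `{Enc A} (b c : A -> bool) :
  Comp b -> Comp c -> Comp (fun a => b a || c a).
Proof.
  intros Hb Hc; apply Comp_ext with (f := fun a => if b a then true else c a).
  - intro a; now destruct (b a).
  - comp.
Qed.

Lemma Comp_negb {A} `{Enc A} (b : A -> bool) : Comp b -> Comp (fun a => negb (b a)).
Proof. intro Hb; apply (Comp_if b (fun _ => false) (fun _ => true)); comp. Qed.

(** * Computability on terms *)

(** The generated principle gives no hypothesis for the arguments nested in the list. *)
Lemma term_ind' (P : term -> Prop) :
  (forall x, P (Var x)) ->
  (forall f ts, (forall t, In t ts -> P t) -> P (Fun f ts)) -> forall t, P t.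
Proof.
  intros HV HF; fix IH 1; intros [x|f ts]; [apply HV|apply HF].
  induction ts as [|t ts IHts]; intros u [].
  - rewrite <- H; apply IH.
  - now apply IHts.
Qed.

Lemma enc_list_In x l : In x l -> x < enc_list l.
Proof.
  induction l as [|y l IH]; simpl; [tauto|].
  pose proof (cpair_ge_fst y (enc_list l)); pose proof (cpair_ge_snd y (enc_list l)).
  intros [->|I]; [|specialize (IH I)]; lia.
Qed.

Lemma enc_subterm_lt f t ts : In t ts -> enc_term t < enc_term (Fun f ts).
Proof.
  intro I; simpl; pose proof (cpair_ge_snd (S f) (enc_list (map enc_term ts))).
  pose proof (enc_list_In _ _ (in_map enc_term _ _ I)); lia.
Qed.

(** Injectivity is asked only at the members of [l], so that the lemma applies inside an induction
    on terms. *)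
Lemma enc_list_map_inj {A} (e : A -> nat) (l l' : list A) :
  (forall a a', In a l -> e a = e a' -> a = a') ->
  enc_list (map e l) = enc_list (map e l') -> l = l'.
Proof.
  revert l'; induction l as [|a l IH]; intros [|a' l'] Inj E; simpl in E;
    try discriminate; [reflexivity|].
  injection E as E; apply cpair_inj in E as [E1 E2]; f_equal.
  - apply Inj; [left; reflexivity|exact E1].
  - apply IH; [|exact E2]; intros; apply Inj; [right|]; assumption.
Qed.

Lemma enc_term_inj t u : enc_term t = enc_term u -> t = u.
Proof.
  revert u; induction t as [x|f ts IH] using term_ind'; intros [y|g us] E;
    simpl in E; apply cpair_inj in E as [E1 E2]; try discriminate.
  - congruence.
  - injection E1 as ->; f_equal; apply (enc_list_map_inj enc_term); auto.
Qed.

(** The entries of the list coded by [n] are below [n], so only smaller numbers need decoding; this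
    fits a strong induction on codes. *)
Lemma enc_list_surj {A} (e : A -> nat) n :
  (forall m, m < n -> exists a, e a = m) -> exists l, enc_list (map e l) = n.
Proof.
  induction n as [n IH] using lt_wf_ind; destruct n as [|n]; intro S.
  - now exists [].
  - pose proof (cpair_unp n) as E.
    pose proof (cpair_ge_fst (unp1 n) (unp2 n)); pose proof (cpair_ge_snd (unp1 n) (unp2 n)).
    destruct (S (unp1 n)) as [a Ha]; [lia|].
    destruct (IH (unp2 n)) as [l Hl]; [lia|intros; apply S; lia|].
    exists (a :: l); simpl; rewrite Ha, Hl; congruence.
Qed.

Lemma enc_term_surj n : exists t, enc_term t = n.
Proof.
  induction n as [n IH] using lt_wf_ind.
  pose proof (cpair_unp n) as E; destruct (unp1 n) as [|f].
  - exists (Var (unp2 n)); exact E.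
  - destruct (enc_list_surj enc_term (unp2 n)) as [ts Hts].
    + intros m L; apply IH; rewrite <- E.
      apply Nat.lt_le_trans with (1 := L), cpair_ge_snd.
    + exists (Fun f ts); simpl; now rewrite Hts.
Qed.

(** The decoder is obtained by choice, yet it is computable: in terms of codes it is the
    identity. *)
Definition dec (n : nat) : term :=
  proj1_sig (constructive_indefinite_description _ (enc_term_surj n)).

Lemma enc_dec n : enc_term (dec n) = n.
Proof. unfold dec; now destruct constructive_indefinite_description. Qed.

Lemma dec_enc t : dec (enc_term t) = t.
Proof. apply enc_term_inj, enc_dec. Qed.

Definition term_eqb (t u : term) : bool := enc t =? enc u.

Lemma term_eqb_eq t u : term_eqb t u = true <-> t = u.
Proof.
  unfold term_eqb; rewrite Nat.eqb_eq; split; [apply enc_term_inj|now intros ->].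
Qed.

Section Terms.
Context {A B : Type} `{Enc A} `{Enc B}.

Lemma Comp_Var (x : A -> nat) : Comp x -> Comp (fun a => Var (x a)).
Proof.
  intros [x' [Cx Hx]]; exists (fun n => cpair 0 (x' n)); split.
  - exact (cmp_comp2 _ _ _ cmp2_cpair (cmp_const 0) Cx).
  - intro a; now rewrite Hx.
Qed.

Lemma Comp_Fun (f : A -> nat) (ts : A -> list term) :
  Comp f -> Comp ts -> Comp (fun a => Fun (f a) (ts a)).
Proof.
  intros [f' [Cf Hf]] [g' [Cg Hg]]; exists (fun n => cpair (S (f' n)) (g' n)); split.
  - exact (cmp_comp2 _ _ _ cmp2_cpair (cmp_comp1 _ _ cmp1_S Cf) Cg).
  - intro a; now rewrite Hf, Hg.
Qed.

Lemma Comp_dec (n : A -> nat) : Comp n -> Comp (fun a => dec (n a)).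
Proof.
  intros [g [Cg Hg]]; exists g; split; [assumption|].
  intro a; rewrite Hg; symmetry; apply enc_dec.
Qed.

Lemma Comp_term_eqb (t u : A -> term) :
  Comp t -> Comp u -> Comp (fun a => term_eqb (t a) (u a)).
Proof. intros Ct Cu; apply Comp_eqb; now apply Comp_enc. Qed.

Lemma Comp_term_case (t : A -> term) (v : A -> nat -> B) (s : A -> nat -> list term -> B) :
  Comp t ->
  Comp (fun p : A * nat => v (fst p) (snd p)) ->
  Comp (fun p : A * (nat * list term) => s (fst p) (fst (snd p)) (snd (snd p))) ->
  Comp (fun a => match t a with Var x => v a x | Fun f ts => s a f ts end).
Proof.
  intros [t' [Ct Ht]] [v' [Cv Hv]] [s' [Cs Hs]].
  exists (fun n => ifz (unp1 (t' n)) (v' (cpair n (unp2 (t' n))))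
    (s' (cpair n (cpair (pred (unp1 (t' n))) (unp2 (t' n)))))); split.
  - pose proof (cmp_comp1 _ _ cmp1_unp1 Ct) as C1.
    pose proof (cmp_comp1 _ _ cmp1_unp2 Ct) as C2.
    apply cmp_ifz; [exact C1| |].
    + exact (cmp_comp1 _ _ Cv (cmp_comp2 _ _ _ cmp2_cpair (cmp_proj 0) C2)).
    + apply (cmp_comp1 _ _ Cs), (cmp_comp2 _ _ _ cmp2_cpair (cmp_proj 0)).
      exact (cmp_comp2 _ _ _ cmp2_cpair (cmp_comp1 _ _ cmp1_pred C1) C2).
  - intro a; rewrite Ht; destruct (t a) as [x|f ts].
    + change (enc (Var x)) with (cpair 0 x); rewrite !unp1_cpair, !unp2_cpair.
      exact (Hv (a, x)).
    + change (enc (Fun f ts)) with (cpair (S f) (enc ts)).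
      rewrite !unp1_cpair, !unp2_cpair; exact (Hs (a, (f, ts))).
Qed.
End Terms.

Definition assoc {B} (d : B) (T : list (term * B)) (t : term) : B :=
  fold_right (fun p r => if term_eqb (fst p) t then snd p else r) d T.

Lemma Comp_assoc {A B} `{Enc A} `{Enc B} (d : A -> B) (T : A -> list (term * B)) t :
  Comp d -> Comp T -> Comp t -> Comp (fun a => assoc (d a) (T a) (t a)).
Proof.
  intros Cd CT Ct; unfold assoc.
  apply (Comp_fold_right T d (fun a p r => if term_eqb (fst p) (t a) then snd p else r));
    comp.
  apply Comp_term_eqb; comp; apply (Comp_compose t fst); comp.
Qed.

(* Since every number codes a term and subterms have smaller codes, the values at
   all terms coded below [k] can be tabulated by recursion on [k]. *)
Lemma Comp_term_rec {A B X} `{Enc A} `{Enc B} `{Enc X} (F : A -> term -> B)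
  (v : A -> nat -> B) (s : A -> nat -> list (term * B) -> B) :
  (forall a x, F a (Var x) = v a x) ->
  (forall a f ts, F a (Fun f ts) = s a f (map (fun t => (t, F a t)) ts)) ->
  Comp (fun p : A * nat => v (fst p) (snd p)) ->
  Comp (fun p : A * (nat * list (term * B)) => s (fst p) (fst (snd p)) (snd (snd p))) ->
  forall (a : X -> A) (t : X -> term), Comp a -> Comp t ->
  Comp (fun x => F (a x) (t x)).
Proof.
  intros FV FF Cv Cs a0 t0 Ca0 Ct0.
  (* One layer of the recursion, reading the values at the arguments from a table [T]. The default
     [v a 0] merely provides an element of [B]. *)
  set (val := fun a T t => match t with
    | Var x => v a x
    | Fun f ts => s a f (map (fun u => (u, assoc (v a 0) T u)) ts) end).
  (* The table at stage [k] covers the terms with codes below [k], hence all proper subterms of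
     [dec k]. *)
  set (tab := fun a => nat_rect (fun _ => list (term * B)) []
                (fun k T => (dec k, val a T (dec k)) :: T)).
  assert (L : forall a k,
    (forall t, enc_term t < k -> assoc (v a 0) (tab a k) t = F a t) /\
    forall t, enc_term t <= k -> val a (tab a k) t = F a t).
  { intros a k.
    assert (V : forall T, (forall t, enc_term t < k -> assoc (v a 0) T t = F a t) ->
      forall t, enc_term t <= k -> val a T t = F a t).
    { intros T HT [x|f ts] Lt; simpl; [now rewrite FV|].
      rewrite FF; f_equal; apply map_ext_in; intros u I; f_equal; apply HT.
      pose proof (enc_subterm_lt f u ts I); lia. }
    enough (forall t, enc_term t < k -> assoc (v a 0) (tab a k) t = F a t) by auto.
    clear V; induction k as [|k IH]; intros t Lt; [lia|]; simpl.
    destruct (term_eqb (dec k) t) eqn:E.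
    - apply term_eqb_eq in E; subst t; rewrite enc_dec in Lt.
      destruct (dec k) as [x|f ts] eqn:D; simpl; [now rewrite FV|].
      rewrite FF; f_equal; apply map_ext_in; intros u I; f_equal; apply IH.
      rewrite <- (enc_dec k), D; now apply enc_subterm_lt.
    - apply IH; enough (enc_term t <> k) by lia; intros <-.
      rewrite dec_enc in E; now rewrite (proj2 (term_eqb_eq t t)) in E. }
  assert (Cval : Comp (fun q : (A * list (term * B)) * term =>
    val (fst (fst q)) (snd (fst q)) (snd q))).
  { unfold val; apply (Comp_term_case snd (fun q => v (fst (fst q)))
      (fun q f ts => s (fst (fst q)) f
         (map (fun u => (u, assoc (v (fst (fst q)) 0) (snd (fst q)) u)) ts))).
    - comp.
    - apply (Comp_compose2 v); comp.
    - apply (Comp_compose _ (fun q : ((A * list (term * B)) * term) * (nat * list term) =>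
        (fst (fst (fst q)), (fst (snd q),
         map (fun u => (u, assoc (v (fst (fst (fst q))) 0) (snd (fst (fst q))) u))
           (snd (snd q))))) Cs).
      comp; apply (Comp_map (fun (q : ((A * list (term * B)) * term) * (nat * list term)) u =>
        (u, assoc (v (fst (fst (fst q))) 0) (snd (fst (fst q))) u))); comp.
      apply Comp_assoc; comp; apply (Comp_compose2 v); comp. }
  assert (Ctab : Comp (fun q : A * nat => tab (fst q) (snd q))).
  { unfold tab; apply Comp_nat_rect with
      (s := fun q k T => (dec k, val (fst q) T (dec k)) :: T); comp.
    - apply Comp_dec; comp.
    - apply (Comp_compose _ (fun q : (A * nat) * (nat * list (term * B)) =>
        ((fst (fst q), snd (snd q)), dec (fst (snd q)))) Cval); comp.
      apply Comp_dec; comp. }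
  apply Comp_ext with (f := fun x => val (a0 x) (tab (a0 x) (enc (t0 x))) (t0 x)).
  - intro x; now apply L.
  - apply (Comp_compose _ (fun x => ((a0 x, tab (a0 x) (enc (t0 x))), t0 x)) Cval); comp.
    apply (Comp_compose _ (fun x => (a0 x, enc (t0 x))) Ctab); comp.
Qed.

(** * Computing the reducts of a term *)

(** Finite lists stand for substitutions so that these can be coded; unlisted variables stay
    fixed. *)
Definition lookup (s : list (nat * term)) (x : nat) : term :=
  fold_right (fun p r => if fst p =? x then snd p else r) (Var x) s.

Fixpoint subterms (t : term) : list term :=
  t :: match t with Var _ => [] | Fun _ ts => flat_map subterms ts end.

(** Matching by brute force: a substitution matching a left-hand side against a term sends its
    variables to subterms of that term, so finitely many assignments have to be tried. *)
Fixpoint candidates (xs : list nat) (ts : list term) : list (list (nat * term)) :=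
  match xs with
  | [] => [[]]
  | x :: xs' =>
      flat_map (fun t => map (fun s => (x, t) :: s) (candidates xs' ts)) ts
  end.

Definition root_reducts (rules : list (term * term)) (t : term) : list term :=
  flat_map (fun lr =>
    flat_map (fun s => if term_eqb (subst (lookup s) (fst lr)) t
                       then [subst (lookup s) (snd lr)] else [])
      (candidates (vars (fst lr)) (subterms t))) rules.

(** Each argument comes paired with its reducts, the form in which [Comp_term_rec] delivers
    recursive values. The result pairs the original arguments with all lists obtained by reducing
    exactly one of them. *)
Definition args_reducts (l : list (term * list term)) : list term * list (list term) :=
  fold_right (fun p r => (fst p :: fst r,
      map (fun u => u :: fst r) (snd p) ++ map (cons (fst p)) (snd r))) ([], []) l.

Fixpoint reducts (rules : list (term * term)) (t : term) : list term :=
  root_reducts rules t ++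
  match t with
  | Var _ => []
  | Fun f ts => map (Fun f) (snd (args_reducts (map (fun u => (u, reducts rules u)) ts)))
  end.

Definition level (rules : list (term * term)) (k : nat) (t : term) : list term :=
  nat_rect (fun _ => list term) [t] (fun _ L => flat_map (reducts rules) L) k.

Fixpoint overb (sg : signature) (t : term) : bool :=
  match t with
  | Var _ => true
  | Fun f ts =>
      existsb (fun p => (fst p =? f) && (snd p =? length ts)) sg && forallb (overb sg) ts
  end.

Definition wf_rule (sg : signature) (lr : term * term) : bool :=
  overb sg (fst lr) && (overb sg (snd lr) &&
  (match fst lr with Var _ => false | Fun _ _ => true end &&
   forallb (fun x => existsb (Nat.eqb x) (vars (fst lr))) (vars (snd lr)))).


Lemma Comp_lookup {A} `{Enc A} (s : A -> list (nat * term)) (x : A -> nat) :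
  Comp s -> Comp x -> Comp (fun a => lookup (s a) (x a)).
Proof.
  intros Cs Cx.
  apply (Comp_fold_right s (fun a => Var (x a))
    (fun a p r => if fst p =? x a then snd p else r)); comp.
  - now apply Comp_Var.
  - apply (Comp_compose x fst); comp.
Qed.

(** [Comp_term_rec] presents arguments together with their values; this lemma and the next two
    separate them again. *)
Lemma map_fst_graph {X Y} (F : X -> Y) l : map fst (map (fun t => (t, F t)) l) = l.
Proof. rewrite map_map; apply map_id. Qed.

Lemma map_snd_graph {X Y} (F : X -> Y) l : map snd (map (fun t => (t, F t)) l) = map F l.
Proof. now rewrite map_map. Qed.

Lemma flat_map_snd_graph {X Y} (F : X -> list Y) l :
  flat_map snd (map (fun t => (t, F t)) l) = flat_map F l.
Proof. now rewrite !flat_map_concat_map, map_map. Qed.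

Lemma Comp_subst {A} `{Enc A} (s : A -> list (nat * term)) (t : A -> term) :
  Comp s -> Comp t -> Comp (fun a => subst (lookup (s a)) (t a)).
Proof.
  apply (Comp_term_rec (fun s => subst (lookup s)) lookup
    (fun _ f l => Fun f (map snd l))).
  - reflexivity.
  - intros; cbn; now rewrite map_snd_graph.
  - apply Comp_lookup; comp.
  - apply Comp_Fun; comp; apply (Comp_map (fun _ => snd)); comp.
Qed.

Lemma Comp_vars {A} `{Enc A} (t : A -> term) : Comp t -> Comp (fun a => vars (t a)).
Proof.
  apply (Comp_term_rec (fun _ : nat => vars) (fun _ x => [x])
    (fun _ f l => flat_map snd l)) with (a := fun _ => 0); comp.
  - reflexivity.
  - intros; cbn; now rewrite flat_map_snd_graph.
  - apply (Comp_flat_map (fun _ => snd)); comp.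
Qed.

Lemma Comp_subterms {A} `{Enc A} (t : A -> term) :
  Comp t -> Comp (fun a => subterms (t a)).
Proof.
  apply (Comp_term_rec (fun _ : nat => subterms) (fun _ x => [Var x])
    (fun _ f l => Fun f (map fst l) :: flat_map snd l)) with (a := fun _ => 0); comp.
  - reflexivity.
  - intros; cbn; now rewrite map_fst_graph, flat_map_snd_graph.
  - apply Comp_Var; comp.
  - apply Comp_Fun; comp; apply (Comp_map (fun _ => fst)); comp.
  - apply (Comp_flat_map (fun _ => snd)); comp.
Qed.

Lemma Comp_candidates {A} `{Enc A} (xs : A -> list nat) (ts : A -> list term) :
  Comp xs -> Comp ts -> Comp (fun a => candidates (xs a) (ts a)).
Proof.
  intros Cx Ct.
  apply Comp_ext with (f := fun a => fold_right (fun x acc =>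
    flat_map (fun t => map (fun s => (x, t) :: s) acc) (ts a)) [[]] (xs a)).
  - intro a; induction (xs a) as [|x l IH]; simpl; [|rewrite IH]; reflexivity.
  - apply Comp_fold_right; comp.
    apply (Comp_flat_map (fun (p : A * (nat * list (list (nat * term)))) t =>
      map (fun s => (fst (snd p), t) :: s) (snd (snd p)))).
    + apply (Comp_map (fun (q : (A * (nat * list (list (nat * term)))) * term) s =>
        (fst (snd (fst q)), snd q) :: s)); comp.
    + apply (Comp_compose ts fst); comp.
Qed.

Lemma Comp_root_reducts {A} `{Enc A} (R : A -> list (term * term)) (t : A -> term) :
  Comp R -> Comp t -> Comp (fun a => root_reducts (R a) (t a)).
Proof.
  intros CR Ct; unfold root_reducts.
  apply (Comp_flat_map (fun a lr => flat_map
    (fun s => if term_eqb (subst (lookup s) (fst lr)) (t a)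
              then [subst (lookup s) (snd lr)] else [])
    (candidates (vars (fst lr)) (subterms (t a))))); comp.
  apply (Comp_flat_map (fun (q : A * (term * term)) s =>
    if term_eqb (subst (lookup s) (fst (snd q))) (t (fst q))
    then [subst (lookup s) (snd (snd q))] else [])).
  - comp; [apply Comp_term_eqb|]; try (apply Comp_subst; comp).
    apply (Comp_compose t (fun q => fst (fst q))); comp.
  - apply Comp_candidates; [apply Comp_vars|apply Comp_subterms]; comp.
    apply (Comp_compose t fst); comp.
Qed.

Lemma Comp_args_reducts {A} `{Enc A} (l : A -> list (term * list term)) :
  Comp l -> Comp (fun a => args_reducts (l a)).
Proof.
  intro Cl; unfold args_reducts.
  apply (Comp_fold_right l (fun _ => ([], [])) (fun _ p r => (fst p :: fst r,
      map (fun u => u :: fst r) (snd p) ++ map (cons (fst p)) (snd r)))); comp.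
  apply Comp_app.
  - apply (Comp_map (fun (q : A * ((term * list term) * (list term * list (list term))))
      u => u :: fst (snd (snd q)))); comp.
  - apply (Comp_map (fun (q : A * ((term * list term) * (list term * list (list term))))
      => cons (fst (fst (snd q))))); comp.
Qed.

Lemma Comp_reducts {A} `{Enc A} (R : A -> list (term * term)) (t : A -> term) :
  Comp R -> Comp t -> Comp (fun a => reducts (R a) (t a)).
Proof.
  apply (Comp_term_rec reducts (fun R x => root_reducts R (Var x) ++ [])
    (fun R f l => root_reducts R (Fun f (map fst l)) ++
                  map (Fun f) (snd (args_reducts l)))).
  - reflexivity.
  - intros; now rewrite map_fst_graph.
  - apply Comp_app; comp; apply Comp_root_reducts; comp; apply Comp_Var; comp.
  - apply Comp_app.
    + apply Comp_root_reducts; comp; apply Comp_Fun; comp.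
      apply (Comp_map (fun _ => fst)); comp.
    + apply (Comp_map (fun (q : list (term * term) * (nat * list (term * list term))) =>
        Fun (fst (snd q)))); [apply Comp_Fun; comp|].
      comp; apply Comp_args_reducts; comp.
Qed.

Lemma Comp_level {A} `{Enc A} (R : A -> list (term * term)) (k : A -> nat) (t : A -> term) :
  Comp R -> Comp k -> Comp t -> Comp (fun a => level (R a) (k a) (t a)).
Proof.
  intros CR Ck Ct; unfold level.
  apply (Comp_nat_rect k (fun a => [t a]) (fun a _ L => flat_map (reducts (R a)) L)); comp.
  apply (Comp_flat_map (fun (q : A * (nat * list term)) => reducts (R (fst q)))); comp.
  apply (Comp_reducts (fun q => R (fst (fst q)))); comp.
  apply (Comp_compose R (fun q => fst (fst q))); comp.
Qed.

Lemma Comp_overb {A} `{Enc A} (sg : A -> signature) (t : A -> term) :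
  Comp sg -> Comp t -> Comp (fun a => overb (sg a) (t a)).
Proof.
  apply (Comp_term_rec overb (fun _ _ => true) (fun sg f l =>
    existsb (fun p => (fst p =? f) && (snd p =? length l)) sg && forallb snd l)).
  - reflexivity.
  - intros; cbn; rewrite length_map; f_equal.
    induction ts; simpl; congruence.
  - comp.
  - apply Comp_andb.
    + apply (Comp_existsb
        (fun (q : signature * (nat * list (term * bool))) (p : nat * nat) =>
        (fst p =? fst (snd q)) && (snd p =? length (snd (snd q))))); comp.
      apply Comp_andb; comp; apply Comp_length; comp.
    + apply (Comp_forallb (fun _ => snd)); comp.
Qed.

Lemma Comp_wf_rule {A} `{Enc A} (sg : A -> signature) (lr : A -> term * term) :
  Comp sg -> Comp lr -> Comp (fun a => wf_rule (sg a) (lr a)).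
Proof.
  intros Cs Cr; unfold wf_rule; repeat apply Comp_andb;
    try (apply Comp_overb; comp).
  - apply (Comp_term_case (fun a => fst (lr a)) (fun _ _ => false) (fun _ _ _ => true));
      comp.
  - apply (Comp_forallb (fun a x => existsb (Nat.eqb x) (vars (fst (lr a)))));
      [|apply Comp_vars; comp].
    apply (Comp_existsb (fun (q : A * nat) => Nat.eqb (snd q))); comp.
    apply Comp_vars; comp; apply (Comp_compose lr fst); comp.
Qed.

(** * Membership in Pi_2 *)

Lemma subst_ext_vars s s' t :
  (forall x, In x (vars t) -> s x = s' x) -> subst s t = subst s' t.
Proof.
  induction t as [x|f ts IH] using term_ind'; simpl; intro E; [apply E; auto|].
  f_equal; apply map_ext_in; intros t I; apply IH; [exact I|].
  intros x Ix; apply E, in_flat_map; eauto.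
Qed.

Lemma subterms_refl t : In t (subterms t).
Proof. destruct t; simpl; auto. Qed.

Lemma subst_var_subterm s t x : In x (vars t) -> In (s x) (subterms (subst s t)).
Proof.
  induction t as [y|f ts IH] using term_ind'; simpl.
  - intros [->|[]]; apply subterms_refl.
  - intros I; right; apply in_flat_map in I as (t & It & I).
    apply in_flat_map; exists (subst s t); split; [now apply in_map|auto].
Qed.

Lemma candidates_In s xs ts :
  (forall x, In x xs -> In (s x) ts) ->
  In (map (fun x => (x, s x)) xs) (candidates xs ts).
Proof.
  induction xs as [|x xs IH]; simpl; intro I; [auto|].
  apply in_flat_map; exists (s x); split; [auto|].
  apply in_map, IH; auto.
Qed.

Lemma lookup_graph s xs x : In x xs -> lookup (map (fun x => (x, s x)) xs) x = s x.
Proof.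
  induction xs as [|y xs IH]; simpl; [tauto|].
  destruct (Nat.eqb_spec y x) as [->|N]; [reflexivity|].
  intros [E|I]; [contradiction|auto].
Qed.

Definition vars_ok (rules : list (term * term)) : Prop :=
  forall l r, In (l, r) rules -> forall x, In x (vars r) -> In x (vars l).

(** For completeness, the matching substitution restricted to the variables of [l] is a candidate,
    and [vars_ok] makes the restriction agree with it on [r] as well. *)
Lemma root_reducts_spec rules t u : vars_ok rules ->
  In u (root_reducts rules t) <->
  exists l r s, In (l, r) rules /\ subst s l = t /\ subst s r = u.
Proof.
  intro V; unfold root_reducts; rewrite in_flat_map; split.
  - intros ([l r] & I & J); apply in_flat_map in J as (s & _ & J); simpl in J.
    destruct (term_eqb _ _) eqn:E; [|destruct J]; apply term_eqb_eq in E.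
    destruct J as [J|[]]; exists l, r, (lookup s); auto.
  - intros (l & r & s & I & <- & <-); exists (l, r); split; [exact I|]; simpl.
    assert (G : forall x, In x (vars l) ->
      lookup (map (fun x => (x, s x)) (vars l)) x = s x)
      by (intros; now apply lookup_graph).
    apply in_flat_map; exists (map (fun x => (x, s x)) (vars l)); split.
    + apply candidates_In; intros; now apply subst_var_subterm.
    + rewrite (subst_ext_vars _ s l G), (proj2 (term_eqb_eq _ _) eq_refl); left.
      apply subst_ext_vars; intros x Ix; apply G, (V l r I x Ix).
Qed.

Lemma args_reducts_fst l : fst (args_reducts l) = map fst l.
Proof. induction l; simpl; congruence. Qed.

Lemma args_reducts_spec l us :
  In us (snd (args_reducts l)) <->
  exists pre p u post, l = pre ++ p :: post /\ In u (snd p) /\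
    us = map fst pre ++ u :: map fst post.
Proof.
  revert us; induction l as [|q l IH]; intro us; simpl.
  - split; [intros []|intros ([|] & ? & ? & ? & E & _); discriminate].
  - rewrite in_app_iff, !in_map_iff, args_reducts_fst; split.
    + intros [(u & <- & I)|(us' & <- & I)].
      * exists [], q, u, l; auto.
      * apply IH in I as (pre & p & u & post & -> & I & ->).
        exists (q :: pre), p, u, post; auto.
    + intros ([|q' pre] & p & u & post & E & I & ->); injection E as -> ->.
      * left; now exists u.
      * right; exists (map fst pre ++ u :: map fst post); split; [reflexivity|].
        apply IH; now exists pre, p, u, post.
Qed.

Lemma reducts_spec R t u : vars_ok (trs_rules R) ->
  In u (reducts (trs_rules R) t) <-> step R t u.
Proof.
  intro V; revert u.
  assert (Root : forall t u, In u (root_reducts (trs_rules R) t) -> step R t u).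
  { intros t' u I; apply root_reducts_spec in I as (l & r & s & I & <- & <-); [|exact V].
    now apply step_root. }
  induction t as [x|f ts IH] using term_ind'; intro u; simpl; rewrite in_app_iff;
    (split; [intros [I|I]; [now apply Root|]|]).
  - destruct I.
  - intro S; left; apply root_reducts_spec; [exact V|].
    remember (Var x) as t; destruct S; [eauto 6|discriminate].
  - apply in_map_iff in I as (us & <- & I).
    apply args_reducts_spec in I as (pre & p & u & post & E & I & ->).
    assert (Ets : ts = map fst pre ++ fst p :: map fst post).
    { rewrite <- (map_fst_graph (reducts (trs_rules R)) ts), E, map_app; reflexivity. }
    assert (Ip : In p (map (fun u => (u, reducts (trs_rules R) u)) ts))
      by (rewrite E, in_app_iff; simpl; auto).
    apply in_map_iff in Ip as (t & <- & It); simpl in *; rewrite Ets.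
    apply step_ctx, IH; assumption.
  - intro S; remember (Fun f ts) as t eqn:Et; destruct S as [l r s I|g pre t t' post S].
    + left; apply root_reducts_spec; [exact V|eauto 6].
    + right; injection Et as -> <-; apply in_map, args_reducts_spec.
      set (G := fun u => (u, reducts (trs_rules R) u)).
      exists (map G pre), (G t), t', (map G post); repeat split.
      * now rewrite map_app.
      * apply IH; [rewrite in_app_iff; simpl; auto|exact S].
      * unfold G; now rewrite !map_fst_graph.
Qed.

Lemma level_spec R k t u : vars_ok (trs_rules R) ->
  In u (level (trs_rules R) k t) -> clos_refl_trans term (step R) t u.
Proof.
  intro V; revert u; induction k as [|k IH]; intro u; simpl.
  - intros [->|[]]; apply rt_refl.
  - rewrite in_flat_map; intros (w & I & J); apply rt_trans with w; [now apply IH|].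
    apply rt_step, reducts_spec; assumption.
Qed.

Lemma level_complete R t u : vars_ok (trs_rules R) ->
  clos_refl_trans term (step R) t u -> exists k, In u (level (trs_rules R) k t).
Proof.
  intros V S; apply clos_rt_rtn1 in S; induction S as [|w u Swu _ [k IH]].
  - exists 0; simpl; auto.
  - exists (S k); simpl; apply in_flat_map; exists w; split; [exact IH|].
    now apply reducts_spec.
Qed.

(** [level] adds steps at the end; inductions on accessibility need the first step split off. *)
Lemma level_split rules k t :
  level rules (S k) t = flat_map (level rules k) (reducts rules t).
Proof.
  induction k as [|k IH].
  - simpl; rewrite app_nil_r; induction (reducts rules t); simpl; congruence.
  - change (level rules (S (S k)) t) with (flat_map (reducts rules) (level rules (S k) t)).
    rewrite IH; generalize (reducts rules t); intro l.
    induction l as [|u l IHl]; [reflexivity|]; simpl.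
    rewrite flat_map_app; f_equal; exact IHl.
Qed.

Lemma level_nil_mono rules j k t : j <= k ->
  level rules j t = [] -> level rules k t = [].
Proof. induction 1 as [|k _ IH]; intro E; [|simpl; rewrite IH]; auto. Qed.

Notation rstep R := (fun u t => step R t u).

(** König's lemma as an induction on accessibility: the finitely many reducts each have an empty
    level, and since levels stay empty once they are, the sum of the indices serves all reducts at
    once. *)
Lemma Acc_level R t : vars_ok (trs_rules R) ->
  Acc (rstep R) t -> exists k, level (trs_rules R) k t = [].
Proof.
  intro V; induction 1 as [t _ IH].
  assert (B : forall l, (forall u, In u l -> step R t u) ->
    exists k, flat_map (level (trs_rules R) k) l = []).
  { induction l as [|u l IHl]; intro Sub; [now exists 0|].
    destruct IHl as [k Hk]; [intros; apply Sub; simpl; auto|].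
    destruct (IH u (Sub u (or_introl eq_refl))) as [j Hj].
    exists (j + k); simpl.
    rewrite (level_nil_mono _ j _ u (Nat.le_add_r j k) Hj); simpl.
    clear - Hk; induction l as [|w l IHl]; [reflexivity|]; simpl in *.
    apply app_eq_nil in Hk as [H1 H2].
    rewrite (level_nil_mono _ k _ w (Nat.le_add_l k j) H1); auto. }
  destruct (B (reducts (trs_rules R) t)) as [k Hk].
  - intros u I; now apply reducts_spec.
  - exists (S k); now rewrite level_split.
Qed.

(** Classically, an inaccessible term has an inaccessible reduct; choosing one again and again
    yields an infinite rewrite sequence. *)
Lemma SN_on_Acc R t : SN_on R t -> Acc (rstep R) t.
Proof.
  intro SN; apply NNPP; intro NA; apply SN.
  set (T := {u : term | ~ Acc (rstep R) u}).
  assert (next : forall a : T, {b : T | step R (proj1_sig a) (proj1_sig b)}).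
  { intros [a Na]; apply constructive_indefinite_description; simpl.
    apply NNPP; intro C; apply Na; constructor; intros b S; apply NNPP; intro Nb.
    apply C; now exists (exist _ b Nb). }
  set (seq := nat_rect (fun _ => T) (exist _ t NA) (fun _ a => proj1_sig (next a))).
  exists (fun i => proj1_sig (seq i)); split; [reflexivity|].
  intro i; exact (proj2_sig (next (seq i))).
Qed.

Lemma Acc_SN_on R t : Acc (rstep R) t -> SN_on R t.
Proof.
  induction 1 as [t _ IH]; intros (seq & <- & S).
  apply (IH (seq 1) (S 0)); exists (fun i => seq (Datatypes.S i)); auto.
Qed.

Lemma Acc_WN_on R t : Acc (rstep R) t -> WN_on R t.
Proof.
  induction 1 as [t _ IH].
  destruct (classic (normal_form R t)) as [N|N].
  - exists t; split; [apply rt_refl|exact N].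
  - apply NNPP in N as [u S]; destruct (IH u S) as (s & Rs & Ns).
    exists s; split; [|exact Ns]; apply rt_trans with u; [now apply rt_step|exact Rs].
Qed.

Lemma SN_on_level R t : vars_ok (trs_rules R) ->
  SN_on R t <-> exists k, level (trs_rules R) k t = [].
Proof.
  intro V; split; [intro SN; now apply Acc_level, SN_on_Acc|].
  intros [k E] (seq & E0 & S).
  (* The [k]-th term of an infinite sequence would lie in the empty level [k]. *)
  enough (I : In (seq k) (level (trs_rules R) k t)) by (rewrite E in I; destruct I).
  clear E; induction k as [|k IH]; simpl; [auto|].
  apply in_flat_map; exists (seq k); split; [exact IH|]; now apply reducts_spec.
Qed.

Definition is_nil {X} (l : list X) : bool := match l with [] => true | _ => false end.

Lemma is_nil_true {X} (l : list X) : is_nil l = true <-> l = [].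
Proof. destruct l; split; easy. Qed.

Lemma WN_on_level R t : vars_ok (trs_rules R) ->
  WN_on R t <-> exists k, existsb (fun u => is_nil (reducts (trs_rules R) u))
                            (level (trs_rules R) k t) = true.
Proof.
  intro V.
  assert (NF : forall s, normal_form R s <-> reducts (trs_rules R) s = []).
  { intro s; unfold normal_form; split.
    - intro N; destruct (reducts (trs_rules R) s) as [|u l] eqn:E; [reflexivity|].
      destruct N; exists u; apply reducts_spec; [exact V|rewrite E; simpl; auto].
    - intros E [u S]; apply reducts_spec in S; [rewrite E in S; destruct S|exact V]. }
  split.
  - intros (s & Rs & N); destruct (level_complete _ _ _ V Rs) as [k I].
    exists k; apply existsb_exists; exists s; split; [exact I|].
    now apply is_nil_true, NF.
  - intros [k E]; apply existsb_exists in E as (s & I & N).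
    exists s; split; [now apply level_spec with k|]; now apply NF, is_nil_true.
Qed.

Lemma overb_spec sg t : overb sg t = true <-> term_over sg t.
Proof.
  induction t as [x|f ts IH] using term_ind'; simpl.
  - split; [intros; constructor|reflexivity].
  - rewrite andb_true_iff, existsb_exists, forallb_forall; split.
    + intros [([g n] & I & E) F]; simpl in E.
      apply andb_true_iff in E as [Eg En].
      apply Nat.eqb_eq in Eg, En; subst g n.
      constructor; [exact I|intros u Iu; apply IH; auto].
    + intro T; inversion T as [|g us I F]; subst; split.
      * exists (f, length ts); split; [exact I|]; simpl; now rewrite !Nat.eqb_refl.
      * intros u Iu; apply IH; auto.
Qed.

Definition wfb (sg : signature) (rules : list (term * term)) : bool :=
  forallb (wf_rule sg) rules.

Lemma wfb_spec R : wfb (trs_sig R) (trs_rules R) = true <-> wf_trs R.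
Proof.
  unfold wfb, wf_trs, wf_rule; rewrite forallb_forall; split.
  - intros W l r I; specialize (W _ I); simpl in W.
    rewrite !andb_true_iff, !overb_spec, forallb_forall in W.
    destruct W as (H1 & H2 & H3 & H4); repeat split; [assumption..| |].
    + intros x ->; discriminate.
    + intros x Ix; specialize (H4 x Ix); apply existsb_exists in H4 as (y & Iy & E).
      apply Nat.eqb_eq in E; congruence.
  - intros W [l r] I; destruct (W l r I) as (H1 & H2 & H3 & H4); simpl.
    rewrite !andb_true_iff, !overb_spec, forallb_forall; repeat split; [assumption..| |].
    + destruct l as [x|]; [now destruct (H3 x)|reflexivity].
    + intros x Ix; apply existsb_exists; exists x; split; [auto|apply Nat.eqb_refl].
Qed.

Lemma wf_vars_ok R : wf_trs R -> vars_ok (trs_rules R).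
Proof. intros W l r I; apply (W l r I). Qed.

Lemma enc_trs_prod R : enc_trs R = enc (trs_sig R, trs_rules R).
Proof. reflexivity. Qed.

Lemma enc_trs_inj R R' : enc_trs R = enc_trs R' -> R = R'.
Proof.
  intro E; apply cpair_inj in E as [E1 E2].
  apply enc_list_map_inj in E1.
  2: { intros [] [] _ E; apply cpair_inj in E as [E E']; simpl in *; congruence. }
  apply enc_list_map_inj in E2.
  2: { intros [] [] _ E; apply cpair_inj in E as [E E']; simpl in *.
       apply enc_term_inj in E, E'; congruence. }
  destruct R, R'; simpl in *; congruence.
Qed.

Lemma enc_trs_surj n : exists R, enc_trs R = n.
Proof.
  destruct (enc_list_surj (fun p : nat * nat => cpair (fst p) (snd p)) (unp1 n))
    as [sg Hsg].
  { intros m _; exists (unp1 m, unp2 m); apply cpair_unp. }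
  destruct (enc_list_surj
    (fun lr => cpair (enc_term (fst lr)) (enc_term (snd lr))) (unp2 n)) as [rs Hrs].
  { intros m _; exists (dec (unp1 m), dec (unp2 m)); simpl.
    rewrite !enc_dec; apply cpair_unp. }
  exists (mkTRS sg rs); unfold enc_trs; simpl; rewrite Hsg, Hrs; apply cpair_unp.
Qed.

(* The existential witness, the universally quantified term, and the TRS. *)
Definition matrix := (nat * (term * (signature * list (term * term))))%type.

(** Every number codes a witness, a term and a system, so the realizer of [b] decides the matrix on
    all numbers. *)
Lemma in_Pi2_of_matrix (b : matrix -> bool) (A : nat -> Prop) :
  Comp b ->
  (forall R, A (enc_trs R) <->
     forall t, exists k, b (k, (t, (trs_sig R, trs_rules R))) = true) ->
  in_Pi 2 A.
Proof.
  intros (g & Cg & Hg) HA.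
  (* Each quantifier puts its variable in front, so the arguments arrive as witness, term,
     system. *)
  set (C := fun v => g (cpair (nth 0 v 0) (cpair (nth 1 v 0) (nth 2 v 0)))).
  exists (fun v => exists z, C (z :: v) = 0); split.
  - exists (fun v => C v = 0); split; [|intro v; reflexivity].
    destruct (cmp_comp1 _ _ Cg (cmp_comp2 _ _ _ cmp2_cpair (cmp_proj 0)
      (cmp_comp2 _ _ _ cmp2_cpair (cmp_proj 1) (cmp_proj 2)))) as [c Hc].
    exists c; intro v; split; intro E.
    + now rewrite <- E.
    (* A value other than 0 must be exactly 1; this holds because the argument is a genuine code, at
       which [g] returns the code of a boolean. *)
    + enough (C v = 1) as E' by (rewrite <- E'; apply Hc).
      unfold C in *; destruct (enc_trs_surj (nth 2 v 0)) as [R ER].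
      set (p := (nth 0 v 0, (dec (nth 1 v 0), (trs_sig R, trs_rules R)))).
      assert (Ep : cpair (nth 0 v 0) (cpair (nth 1 v 0) (nth 2 v 0)) = enc p).
      { rewrite <- ER, <- (enc_dec (nth 1 v 0)) at 1; reflexivity. }
      rewrite Ep, Hg in *.
      destruct (b _); [now destruct E|reflexivity].
  - intro v; destruct (enc_trs_surj (hd 0 v)) as [R ER]; rewrite <- ER, HA.
    assert (K : forall t k, C (k :: enc_term t :: v) = 0 <->
      b (k, (t, (trs_sig R, trs_rules R))) = true).
    { intros t k; unfold C; simpl nth.
      replace (nth 0 v 0) with (enc_trs R) by (destruct v; exact ER).
      change (g (enc (k, (t, (trs_sig R, trs_rules R)))) = 0 <->
        b (k, (t, (trs_sig R, trs_rules R))) = true).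
      rewrite Hg; now destruct (b _). }
    split.
    + intros H y; destruct (H (dec y)) as [k Hk]; exists k.
      rewrite <- (enc_dec y); now apply K.
    + intros H t; destruct (H (enc_term t)) as [k Hk]; exists k; now apply K.
Qed.

(** Well-formedness is decidable and goes into the matrix, as does the vacuous acceptance of terms
    outside the signature. *)
Lemma normalizing_in_Pi2 (P : trs -> term -> Prop)
  (b : list (term * term) -> nat -> term -> bool) :
  Comp (fun p : matrix =>
    b (snd (snd (snd p))) (fst p) (fst (snd p))) ->
  (forall R t, vars_ok (trs_rules R) ->
     P R t <-> exists k, b (trs_rules R) k t = true) ->
  in_Pi 2 (fun n => exists R, wf_trs R /\ enc_trs R = n /\
                      forall t, term_over (trs_sig R) t -> P R t).
Proof.
  intros Cb Hb.
  apply (in_Pi2_of_matrix (fun p =>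
    wfb (fst (snd (snd p))) (snd (snd (snd p))) &&
    (negb (overb (fst (snd (snd p))) (fst (snd p))) ||
     b (snd (snd (snd p))) (fst p) (fst (snd p))))).
  - apply Comp_andb; [|apply Comp_orb; [apply Comp_negb, Comp_overb; comp|exact Cb]].
    apply (Comp_forallb (fun p : matrix => wf_rule (fst (snd (snd p))))); comp.
    apply Comp_wf_rule; comp.
  - intro R; simpl; split.
    + intros (R' & W & E & H) t; apply enc_trs_inj in E; subst R'.
      rewrite (proj2 (wfb_spec R) W); simpl.
      destruct (overb (trs_sig R) t) eqn:O; [|now exists 0].
      apply overb_spec in O; apply (Hb R t (wf_vars_ok R W)); auto.
    + intro H; assert (W : wf_trs R).
      (* Every instance of the matrix contains the well-formedness test, so any term reveals it. *)
      { apply wfb_spec; destruct (H (Var 0)) as [k Hk].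
        now apply andb_true_iff in Hk. }
      exists R; split; [exact W|split; [reflexivity|]]; intros t O; apply overb_spec in O.
      apply (Hb R t (wf_vars_ok R W)); destruct (H t) as [k Hk]; exists k.
      rewrite O in Hk; now apply andb_true_iff in Hk.
Qed.

Lemma Comp_is_nil {A X} `{Enc A} `{Enc X} (l : A -> list X) :
  Comp l -> Comp (fun a => is_nil (l a)).
Proof.
  intro Cl; apply (Comp_list_case l (fun _ => true) (fun _ _ _ => false)); comp.
Qed.

Lemma SN_codes_in_Pi2 : in_Pi 2 SN_codes.
Proof.
  apply (normalizing_in_Pi2 SN_on (fun rules k t => is_nil (level rules k t))).
  - apply Comp_is_nil, Comp_level; comp.
  - intros R t V; rewrite (SN_on_level R t V).
    split; intros [k E]; exists k; now apply is_nil_true.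
Qed.

Lemma WN_codes_in_Pi2 : in_Pi 2 WN_codes.
Proof.
  apply (normalizing_in_Pi2 WN_on (fun rules k t =>
    existsb (fun u => is_nil (reducts rules u)) (level rules k t))).
  - apply (Comp_existsb (fun (p : matrix) u => is_nil (reducts (snd (snd (snd p))) u)));
      [apply Comp_is_nil, Comp_reducts; comp|apply Comp_level; comp].
  - exact WN_on_level.
Qed.

(** * Termination by semantic labelling *)

Section Labelling.
Variables (R : trs) (D : Type) (d0 : D) (I : nat -> list D -> D).
Variables (W : Type) (ltW : W -> W -> Prop) (m : nat -> list D -> W).

Fixpoint ev (a : nat -> D) (t : term) : D :=
  match t with Var x => a x | Fun f ts => I f (map (ev a) ts) end.

Hypothesis wfW : well_founded ltW.
Hypothesis varsR : vars_ok (trs_rules R).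
Hypothesis model : forall l r a, In (l, r) (trs_rules R) -> ev a l = ev a r.
(** The label of a symbol is [m] applied to it and to the values of its arguments. Constructors of
    [r] are compared too, so they need small labels. *)
Hypothesis decreasing : forall l r, In (l, r) (trs_rules R) ->
  exists f ls, l = Fun f ls /\
    forall a g ts, In (Fun g ts) (subterms r) ->
      ltW (m g (map (ev a) ts)) (m f (map (ev a) ls)).

Lemma ev_subst a s t : ev a (subst s t) = ev (fun x => ev a (s x)) t.
Proof.
  induction t as [x|f ts IH] using term_ind'; simpl; [reflexivity|].
  f_equal; rewrite map_map; now apply map_ext_in.
Qed.

Lemma ev_step a t u : step R t u -> ev a t = ev a u.
Proof.
  induction 1 as [l r s Il|f pre t t' post _ IH].
  - rewrite !ev_subst; now apply model.
  - simpl; now rewrite !map_app; simpl; rewrite IH.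
Qed.

Definition args_step (us ts : list term) : Prop :=
  exists pre t t' post, ts = pre ++ t :: post /\ us = pre ++ t' :: post /\ step R t t'.

(** A step in a nonempty list is a step in its head or in its tail, so a nested induction on the
    accessibility of both suffices. *)
Lemma Acc_args ts : (forall t, In t ts -> Acc (rstep R) t) -> Acc args_step ts.
Proof.
  induction ts as [|t ts IH]; intro H.
  - constructor; intros us ([|] & ? & ? & ? & E & _); discriminate.
  - assert (At : Acc (rstep R) t) by (apply H; simpl; auto).
    assert (Ats : Acc args_step ts) by (apply IH; intros; apply H; simpl; auto).
    clear H IH; revert ts Ats; induction At as [t _ IHt].
    induction 1 as [ts Ats IHts].
    constructor; intros us ([|q pre] & t1 & t2 & post & E & -> & S);
      injection E as -> ->; simpl.
    + apply IHt; [exact S|now constructor].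
    + apply IHts; now exists pre, t1, t2, post.
Qed.

Lemma Acc_subterm t u : Acc (rstep R) t -> In u (subterms t) -> Acc (rstep R) u.
Proof.
  revert u; induction t as [x|f ts IH] using term_ind'; intros u A; simpl.
  - intros [<-|[]]; exact A.
  - intros [<-|J]; [exact A|]; apply in_flat_map in J as (t & It & J).
    apply (IH t It); [|exact J]; clear IH J u.
    apply in_split in It as (pre & post & ->).
    remember (Fun f (pre ++ t :: post)) as v eqn:Ev; revert t Ev.
    induction A as [v _ IH]; intros t ->; constructor; intros t' S.
    apply (IH (Fun f (pre ++ t' :: post))); [now apply step_ctx|reflexivity].
Qed.

Lemma Acc_args_inv us ts :
  (forall t, In t ts -> Acc (rstep R) t) -> args_step us ts ->
  forall u, In u us -> Acc (rstep R) u.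
Proof.
  intros H (pre & t & t' & post & -> & -> & S) u Iu.
  apply in_app_iff in Iu as [Iu|[<-|Iu]].
  - apply H, in_app_iff; auto.
  - apply (Acc_inv (H t (in_elt t pre post))); exact S.
  - apply H, in_app_iff; simpl; auto.
Qed.

(* Semantic labelling: relabelled by the values of their arguments, the symbols
   of a right-hand side are all smaller than the root of the left-hand side. *)
Theorem labelled_termination : forall t, Acc (rstep R) t.
Proof.
  set (a0 := fun _ : nat => d0).
  assert (Main : forall w f ts, m f (map (ev a0) ts) = w ->
    (forall t, In t ts -> Acc (rstep R) t) -> Acc (rstep R) (Fun f ts)).
  { intro w; induction w as [w IHw] using (well_founded_ind wfW); intros f ts Ew Ats.
    assert (Al := Acc_args ts Ats); revert Ew Ats; induction Al as [ts _ IHts].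
    intros Ew Ats; constructor; intros u S.
    remember (Fun f ts) as v eqn:Ev; destruct S as [l r s Il|g pre t1 t2 post S].
    - destruct (decreasing l r Il) as (f' & ls & -> & Dec).
      simpl in Ev; injection Ev as -> <-.
      (* The instance of [r] is built bottom-up: its variables stand for subterms of the accessible
         arguments of the redex, and its symbols have smaller labels, so that the outer induction
         applies to them. *)
      assert (G : forall q, (forall v, In v (subterms q) -> In v (subterms r)) ->
        (forall x, In x (vars q) -> In x (vars r)) -> Acc (rstep R) (subst s q)).
      { induction q as [x|g us IHq] using term_ind'; intros Hq Hv.
        - assert (Ix : In x (vars (Fun f ls)))
            by (apply (varsR _ _ Il), Hv; simpl; auto).
          simpl in Ix; apply in_flat_map in Ix as (q & Iq & Ix).
          apply Acc_subterm with (subst s q); [apply Ats; now apply in_map|].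
          now apply subst_var_subterm.
        - simpl; apply (IHw (m g (map (ev a0) (map (subst s) us)))); [|reflexivity|].
          + rewrite <- Ew, !map_map.
            rewrite (map_ext _ _ (ev_subst a0 s) us), (map_ext _ _ (ev_subst a0 s) ls).
            apply Dec, Hq, subterms_refl.
          + intros t It; apply in_map_iff in It as (q & <- & Iq).
            apply (IHq q Iq).
            * intros v Iv; apply Hq; simpl; right; apply in_flat_map; eauto.
            * intros x Ix; apply Hv; simpl; apply in_flat_map; eauto. }
      apply G; auto.
    (* A step inside an argument preserves all values, hence the label, and the inner induction on
       the arguments applies. *)
    - injection Ev as -> <-.
      assert (St : args_step (pre ++ t2 :: post) (pre ++ t1 :: post))
        by (exists pre, t1, t2, post; auto).
      apply IHts; [exact St| |].
      + rewrite <- Ew, !map_app; simpl; now rewrite (ev_step a0 _ _ S).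
      + now apply (Acc_args_inv _ _ Ats). }
  intro t; induction t as [x|f ts IH] using term_ind';
    [|now apply (Main _ f ts eq_refl)].
  constructor; intros u S; exfalso; remember (Var x) as t.
  destruct S as [l r s Il|]; [|discriminate].
  destruct (decreasing l r Il) as (f & ls & -> & _); discriminate.
Qed.
End Labelling.

(** * The rewrite system of an evaluation search *)

Notation tZ := (Fun 0 []).
Notation tS n := (Fun 1 [n]).
Notation tnil := (Fun 2 []).
Notation tcons a l := (Fun 3 [a; l]).
Notation tcZero := (Fun 4 []).
Notation tcSucc := (Fun 5 []).
Notation tcProj i := (Fun 6 [i]).
Notation tcComp f gs := (Fun 7 [f; gs]).
Notation tcRec f g := (Fun 8 [f; g]).
Notation tcMu f := (Fun 9 [f]).
Notation tEval c v K := (Fun 10 [c; v; K]).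
Notation tRet y K := (Fun 11 [y; K]).
(* The [k...] are the frames of the evaluation stack: [kArgs gs v K] awaits the
   value of an argument, with the codes [gs] still to be evaluated on [v];
   [kCons w K] awaits the values of the arguments after [w]. *)
Notation kHalt := (Fun 12 []).
Notation kComp f K := (Fun 13 [f; K]).
Notation kArgs gs v K := (Fun 14 [gs; v; K]).
Notation kCons w K := (Fun 15 [w; K]).
Notation kRec g n v K := (Fun 16 [g; n; v; K]).
Notation kMu f n v K := (Fun 17 [f; n; v; K]).
Notation tInit y a := (Fun 18 [y; a]).
Notation tGo := (Fun 19 []).
Notation tClock k s := (Fun 20 [k; s]).
Notation tRun y w b := (Fun 21 [y; w; b]).
Notation V := Var.

Definition sgn : signature :=
  [(0,0); (1,1); (2,0); (3,2); (4,0); (5,0); (6,1); (7,2); (8,2); (9,1); (10,3);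
   (11,2); (12,0); (13,2); (14,3); (15,2); (16,4); (17,4); (18,2); (19,0); (20,2);
   (21,3)].

(* A list of codes is evaluated by [tEval] as if it were a code, the result
   being a list. *)
Definition eval_rules : list (term * term) :=
  [(tInit (tS (V 1)) (V 2), tInit (V 1) (tS (V 2)));
   (tEval tcZero (V 1) (V 2), tRet tZ (V 2));
   (tEval tcSucc tnil (V 2), tRet (tS tZ) (V 2));
   (tEval tcSucc (tcons (V 1) (V 3)) (V 2), tRet (tS (V 1)) (V 2));
   (tEval (tcProj (V 1)) tnil (V 2), tRet tZ (V 2));
   (tEval (tcProj tZ) (tcons (V 1) (V 3)) (V 2), tRet (V 1) (V 2));
   (tEval (tcProj (tS (V 4))) (tcons (V 1) (V 3)) (V 2),
      tEval (tcProj (V 4)) (V 3) (V 2));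
   (tEval (tcComp (V 1) (V 2)) (V 3) (V 4), tEval (V 2) (V 3) (kComp (V 1) (V 4)));
   (tEval tnil (V 1) (V 2), tRet tnil (V 2));
   (tEval (tcons (V 1) (V 2)) (V 3) (V 4),
      tEval (V 1) (V 3) (kArgs (V 2) (V 3) (V 4)));
   (tRet (V 1) (kArgs (V 2) (V 3) (V 4)), tEval (V 2) (V 3) (kCons (V 1) (V 4)));
   (tRet (V 1) (kCons (V 2) (V 3)), tRet (tcons (V 2) (V 1)) (V 3));
   (tRet (V 1) (kComp (V 2) (V 3)), tEval (V 2) (V 1) (V 3));
   (tEval (tcRec (V 1) (V 2)) (tcons tZ (V 3)) (V 4), tEval (V 1) (V 3) (V 4));
   (tEval (tcRec (V 1) (V 2)) (tcons (tS (V 5)) (V 3)) (V 4),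
      tEval (tcRec (V 1) (V 2)) (tcons (V 5) (V 3)) (kRec (V 2) (V 5) (V 3) (V 4)));
   (tRet (V 1) (kRec (V 2) (V 3) (V 4) (V 5)),
      tEval (V 2) (tcons (V 3) (tcons (V 1) (V 4))) (V 5));
   (tEval (tcMu (V 1)) (V 2) (V 3),
      tEval (V 1) (tcons tZ (V 2)) (kMu (V 1) tZ (V 2) (V 3)));
   (tRet tZ (kMu (V 1) (V 2) (V 3) (V 4)), tRet (V 2) (V 4));
   (tRet (tS (V 5)) (kMu (V 1) (V 2) (V 3) (V 4)),
      tEval (V 1) (tcons (tS (V 2)) (V 3)) (kMu (V 1) (tS (V 2)) (V 3) (V 4)))].

(* [tInit] copies its first argument to an accumulator, so that evaluation only
   ever starts on a genuine numeral. *)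
Definition init_rule (c x : term) : term * term :=
  (tInit tZ (V 1), tEval c (tcons (V 1) (tcons x tnil)) kHalt).

Definition machine (c x : term) : list (term * term) := init_rule c x :: eval_rules.

(** Variable 0 is reserved for the clock; the rules of the machine only use variables from 1 on. *)
Definition clocked (lr : term * term) : term * term :=
  (tClock (tS (V 0)) (fst lr), tClock (V 0) (snd lr)).

Definition search_trs (c x : term) : trs :=
  mkTRS sgn
    ((tRun (V 0) (V 1) tGo, tRun (V 0) (tS (V 1)) (tClock (V 1) (tInit (V 0) tZ)))
     :: (tClock tZ (V 0), tGo)
     :: map clocked (machine c x)).

Fixpoint num (n : nat) : term := match n with 0 => tZ | S m => tS (num m) end.

Definition tlist (ts : list term) : term := fold_right (fun t l => tcons t l) tnil ts.

Definition vec (v : list nat) : term := tlist (map num v).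

Fixpoint code (c : prcode) : term :=
  match c with
  | cZero => tcZero
  | cSucc => tcSucc
  | cProj i => tcProj (num i)
  | cComp f gs => tcComp (code f) (tlist (map code gs))
  | cRec f g => tcRec (code f) (code g)
  | cMu f => tcMu (code f)
  end.

(* The symbols below 20 are the constructors of the rewrite system. *)
Fixpoint data (t : term) : bool :=
  match t with Var _ => true | Fun f ts => (f <? 20) && forallb data ts end.

(** This is required of the terms spliced into [init_rule]: being closed, they are fixed by
    substitutions, and being built from constructors, they create no redexes. *)
Definition ground (t : term) : bool :=
  overb sgn t && data t && is_nil (vars t).

(** * The machine: determinism and simulation of evaluation *)

Section Machine.
Variables c x : term.
Hypothesis ground_c : ground c = true.
Hypothesis ground_x : ground x = true.

Lemma ground_vars t : ground t = true -> vars t = [].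
Proof. unfold ground; rewrite !andb_true_iff, is_nil_true; tauto. Qed.

Lemma ground_subst t s : ground t = true -> subst s t = t.
Proof.
  intro G; apply ground_vars in G.
  transitivity (subst Var t).
  - apply subst_ext_vars; rewrite G; intros ? [].
  - clear; induction t as [y|f ts IH] using term_ind'; simpl; [reflexivity|].
    f_equal; rewrite <- (map_id ts) at 2; now apply map_ext_in.
Qed.

Lemma subst_c s : subst s c = c.
Proof. exact (ground_subst c s ground_c). Qed.

Lemma subst_x s : subst s x = x.
Proof. exact (ground_subst x s ground_x). Qed.

Lemma search_trs_wf : wf_trs (search_trs c x).
Proof.
  apply wfb_spec.
  pose proof (ground_vars c ground_c) as Vc; pose proof (ground_vars x ground_x) as Vx.
  assert (Oc : overb sgn c = true)
    by (unfold ground in ground_c; now rewrite !andb_true_iff in ground_c).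
  assert (Ox : overb sgn x = true)
    by (unfold ground in ground_x; now rewrite !andb_true_iff in ground_x).
  assert (overb_Fun : forall f ts, overb sgn (Fun f ts) =
    existsb (fun p => (fst p =? f) && (snd p =? length ts)) sgn && forallb (overb sgn) ts)
    by reflexivity.
  (* Only this rule contains the unknown terms [c] and [x]; all others are checked by
     computation. *)
  assert (W : wf_rule sgn (clocked (init_rule c x)) = true).
  { unfold wf_rule, clocked, init_rule; cbn [fst snd vars flat_map].
    rewrite Vc, Vx; do 4 (rewrite !overb_Fun; cbn [forallb]).
    rewrite Oc, Ox; reflexivity. }
  unfold wfb; cbn [search_trs trs_sig trs_rules forallb map machine eval_rules].
  rewrite W; reflexivity.
Qed.

Lemma machine_vars_ok : vars_ok (machine c x).
Proof.
  intros l r; cbn [machine eval_rules init_rule In]; intros I y.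
  repeat (destruct I as [I|I]; [injection I as <- <-|]); try destruct I; cbn;
    rewrite ?(ground_vars c ground_c), ?(ground_vars x ground_x); simpl; tauto.
Qed.

(** Left-hand sides of different rules have no common instance: some constructor tells them
    apart. *)
Lemma machine_deterministic l r l' r' s s' :
  In (l, r) (machine c x) -> In (l', r') (machine c x) ->
  subst s l = subst s' l' -> subst s r = subst s' r'.
Proof.
  cbn [machine eval_rules init_rule In].
  intros I J E;
    repeat (destruct I as [I|I]; [injection I as <- <-|]); try destruct I;
    repeat (destruct J as [J|J]; [injection J as <- <-|]); try destruct J;
    cbn in E |- *; try discriminate E; rewrite ?subst_c, ?subst_x; congruence.
Qed.

(** The machine rewrites at the root only. By determinism, taking the first root reduct loses
    nothing. *)
Definition next (t : term) : option term := hd_error (root_reducts (machine c x) t).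

Lemma next_rule l r s :
  In (l, r) (machine c x) -> next (subst s l) = Some (subst s r).
Proof.
  intro I.
  assert (J : In (subst s r) (root_reducts (machine c x) (subst s l)))
    by (apply root_reducts_spec; [exact machine_vars_ok|now exists l, r, s]).
  unfold next; destruct (root_reducts _ _) as [|u us] eqn:E; [destruct J|].
  assert (K : In u (root_reducts (machine c x) (subst s l)))
    by (rewrite E; simpl; auto).
  apply root_reducts_spec in K as (l' & r' & s' & I' & El & <-);
    [|exact machine_vars_ok].
  simpl; f_equal; symmetry; now apply (machine_deterministic l r l' r').
Qed.

Lemma next_sound t u : next t = Some u ->
  exists l r s, In (l, r) (machine c x) /\ subst s l = t /\ subst s r = u.
Proof.
  unfold next; intro E; apply root_reducts_spec; [exact machine_vars_ok|].
  destruct (root_reducts _ _); [discriminate|injection E as ->; simpl; auto].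
Qed.

Fixpoint run (n : nat) (t : term) : option term :=
  match n with
  | 0 => Some t
  | S m => match next t with Some u => run m u | None => None end
  end.

Lemma run_add n k t :
  run (n + k) t = match run n t with Some u => run k u | None => None end.
Proof.
  revert t; induction n as [|n IH]; intro t; simpl; [reflexivity|].
  destruct (next t); auto.
Qed.

Definition reaches (t u : term) : Prop := exists n, run n t = Some u.

(** Getting stuck counts as halting, on meaningless terms as well. *)
Definition halts (t : term) : Prop := exists n, run n t = None.

Lemma reaches_trans t u v : reaches t u -> reaches u v -> reaches t v.
Proof. intros [n En] [k Ek]; exists (n + k); now rewrite run_add, En. Qed.

Lemma halts_reaches t u : reaches t u -> halts u -> halts t.
Proof. intros [n En] [k Ek]; exists (n + k); now rewrite run_add, En. Qed.

Lemma next_halts t : next t = None -> halts t.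
Proof. intro E; exists 1; simpl; now rewrite E. Qed.

Lemma run_None_mono n k t : n <= k -> run n t = None -> run k t = None.
Proof.
  intros L E; replace k with (n + (k - n)) by lia; now rewrite run_add, E.
Qed.

(* Substitutions are given by the lists of the values of the variables 1, 2, ... *)
Definition args (ts : list term) (i : nat) : term := nth (pred i) ts tZ.

Lemma next_nth i ts l r : nth_error (machine c x) i = Some (l, r) ->
  next (subst (args ts) l) = Some (subst (args ts) r).
Proof. intro E; apply next_rule, (nth_error_In _ i E). Qed.

Lemma rule i ts l r : nth_error (machine c x) i = Some (l, r) ->
  forall u, reaches (subst (args ts) r) u -> reaches (subst (args ts) l) u.
Proof.
  intros E u; apply reaches_trans; exists 1; simpl; now rewrite (next_nth i ts l r E).
Qed.

Lemma reaches_refl t : reaches t t.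
Proof. now exists 0. Qed.

(** Here [i] is the position of the rule in [machine], counted from 0 with the starting rule
    first. *)
Ltac mstep i ts := apply (rule i ts _ _ eq_refl); cbn.

(** Structural recursion on derivations is used directly, because [ev_mu] keeps subderivations under
    an existential quantifier. The stack [K] is arbitrary so that recursive calls may push
    frames. *)
Lemma simulate : forall p v y, eval p v y -> forall K,
  reaches (tEval (code p) (vec v) K) (tRet (num y) K)
with simulate_list : forall ps v ws, evalL ps v ws -> forall K,
  reaches (tEval (tlist (map code ps)) (vec v) K) (tRet (vec ws) K).
Proof.
  - intros p v y H; destruct H as [v|v|i v|f gs v ws y Hgs Hf|f g v y Hf
      |f g n v y z Hrec Hg|f v n Hn Hlt]; intro K; cbn [code].
    + mstep 2 [vec v; K]; apply reaches_refl.
    + destruct v as [|a v].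
      * mstep 3 [tZ; K]; apply reaches_refl.
      * mstep 4 [num a; K; vec v]; apply reaches_refl.
    + revert v; induction i as [|i IH]; intros [|a v].
      * mstep 5 [tZ; K]; apply reaches_refl.
      * mstep 6 [num a; K; vec v]; apply reaches_refl.
      * mstep 5 [num (S i); K]; apply reaches_refl.
      * mstep 7 [num a; K; vec v; num i]; apply IH.
    + mstep 8 [code f; tlist (map code gs); vec v; K].
      eapply reaches_trans; [apply (simulate_list gs v ws Hgs)|].
      mstep 13 [vec ws; code f; K]; now apply simulate.
    + mstep 14 [code f; code g; vec v; K]; now apply simulate.
    + mstep 15 [code f; code g; vec v; K; num n].
      eapply reaches_trans; [apply (simulate _ _ _ Hrec)|].
      mstep 16 [num y; code g; num n; vec v; K]; apply (simulate _ _ _ Hg).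
    + mstep 17 [code f; vec v; K].
      (* Each value below [n] fails the test, so the loop counter climbs up to [n]. *)
      assert (G : forall k, k <= n ->
        reaches (tEval (code f) (tcons tZ (vec v)) (kMu (code f) tZ (vec v) K))
          (tEval (code f) (tcons (num k) (vec v)) (kMu (code f) (num k) (vec v) K))).
      { induction k as [|k IH]; intro L; [apply reaches_refl|].
        eapply reaches_trans; [apply IH; lia|].
        destruct (Hlt k L) as [y Hy].
        eapply reaches_trans; [apply (simulate _ _ _ Hy)|].
        mstep 19 [code f; num k; vec v; K; num y]; apply reaches_refl. }
      eapply reaches_trans; [apply (G n (le_n n))|].
      eapply reaches_trans; [apply (simulate _ _ _ Hn)|].
      mstep 18 [code f; num n; vec v; K]; apply reaches_refl.
  - intros ps v ws H; destruct H as [v|g gs v w ws Hg Hgs]; intro K; cbn [map tlist fold_right].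
    + mstep 9 [vec v; K]; apply reaches_refl.
    + mstep 10 [code g; tlist (map code gs); vec v; K].
      eapply reaches_trans; [apply (simulate _ _ _ Hg)|].
      mstep 11 [num w; tlist (map code gs); vec v; K].
      eapply reaches_trans; [apply (simulate_list _ _ _ Hgs)|].
      mstep 12 [vec ws; num w; K]; apply reaches_refl.
Qed.

#[local] Opaque next.

Lemma halts_final t : halts (tRet t kHalt).
Proof.
  apply next_halts; destruct (next _) as [u|] eqn:E; [exfalso|reflexivity].
  apply next_sound in E as (l & r & s & I & E & _).
  cbn [machine eval_rules init_rule In] in I.
  repeat (destruct I as [I|I]; [injection I as <- <-; discriminate E|]); destruct I.
Qed.

(** Every round of the loop takes at least one step and leads to the same loop with a larger
    counter, so a halting time could be decreased forever. *)
Lemma mu_diverges p v : (forall m, eval p (m :: v) 1) ->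
  forall n, run n (tEval (code (cMu p)) (vec v) kHalt) <> None.
Proof.
  intros H n E.
  set (loop := fun m => tEval (code p) (vec (m :: v)) (kMu (code p) (num m) (vec v) kHalt)).
  assert (D : forall n m, run n (loop m) <> None).
  { clear n E; induction n as [n IH] using lt_wf_ind; intros m E.
    destruct (simulate _ _ _ (H m) (kMu (code p) (num m) (vec v) kHalt)) as [k Ek].
    (* The evaluation takes [k] steps; the extra one increments the counter, the value 1 being
       [tS tZ]. *)
    assert (Es : run (k + 1) (loop m) = Some (loop (S m))).
    { unfold loop; rewrite run_add, Ek; simpl run.
      pose proof (next_nth 19 [code p; num m; vec v; kHalt; tZ] _ _ eq_refl) as N.
      cbn in N; cbn; now rewrite N. }
    destruct (le_lt_dec (k + 1) n) as [L|L].
    - apply (IH (n - (k + 1)) ltac:(lia) (S m)).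
      replace n with (k + 1 + (n - (k + 1))) in E by lia.
      now rewrite run_add, Es in E.
    - rewrite (run_None_mono n (k + 1)) in Es; [discriminate|lia|exact E]. }
  apply (D n 0), (run_None_mono n); [lia|].
  assert (Es : run 1 (tEval (code (cMu p)) (vec v) kHalt) = Some (loop 0)).
  { pose proof (next_nth 17 [code p; vec v; kHalt] _ _ eq_refl) as N.
    cbn in N |- *; now rewrite N. }
  pose proof (run_None_mono n (1 + n) _ ltac:(lia) E) as E'.
  now rewrite run_add, Es in E'.
Qed.

Definition start (y : nat) : term := tEval c (tcons (num y) (tcons x tnil)) kHalt.

Lemma init_num y a : reaches (tInit (num y) (num a)) (start (y + a)).
Proof.
  revert a; induction y as [|y IH]; intro a.
  - mstep 0 [num a]; rewrite subst_c, subst_x; apply reaches_refl.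
  - mstep 1 [num y; num a]; replace (S (y + a)) with (y + S a) by lia.
    apply (IH (S a)).
Qed.

(** Copying peels one [tS] at a time off an arbitrary term [y]. Either it gets stuck at something
    that is not a numeral, or it starts the evaluation on a genuine number. *)
Lemma init_halts : (forall n, halts (start n)) ->
  forall y a, halts (tInit y (num a)).
Proof.
  intro H; assert (Stuck : forall y, y = tZ \/ (exists y', y = tS y') \/
    forall a, next (tInit y a) = None).
  { intro y; destruct (classic (y = tZ)) as [|N1]; [auto|].
    destruct (classic (exists y', y = tS y')) as [|N2]; [auto|].
    right; right; intro a; destruct (next _) as [u|] eqn:E; [exfalso|reflexivity].
    apply next_sound in E as (l & r & s & I & E & _).
    cbn [machine eval_rules init_rule In] in I.
    destruct I as [I|[I|I]]; [injection I as <- <-..|].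
    - injection E as E _; now destruct N1.
    - injection E as E _; destruct N2; eauto.
    - repeat (destruct I as [I|I]; [injection I as <- <-; discriminate E|]); destruct I. }
  intro y; induction y as [v|f ts IH] using term_ind'; intro a.
  - destruct (Stuck (Var v)) as [E|[[y' E]|N]]; [discriminate..|apply next_halts, N].
  - destruct (Stuck (Fun f ts)) as [->|[[y' E]|N]]; [| |apply next_halts, N].
    + exact (halts_reaches _ _ (init_num 0 a) (H _)).
    + injection E as -> ->; apply halts_reaches with (tInit y' (num (S a))).
      * apply (rule 1 [y'; num a] _ _ eq_refl), reaches_refl.
      * apply IH; simpl; auto.
Qed.

(** * Termination when every search succeeds *)

Fixpoint depth (t : term) : nat := match t with tS u => S (depth u) | _ => 0 end.

(** Constructors denote themselves. A clock has value [tGo] if the machine survives the allotted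
    steps, as rewriting would produce; otherwise it has the value [tZ], which serves only to differ
    from [tGo]. Giving [tRun] a constant value validates the search rule. *)
Definition interp (f : nat) (vs : list term) : term :=
  match f, vs with
  | 20, [k; t] => match run (depth k) t with Some _ => tGo | None => tZ end
  | 21, _ => tZ
  | _, _ => Fun f vs
  end.

Lemma data_Fun f ts : data (Fun f ts) = true <->
  f < 20 /\ forall t, In t ts -> data t = true.
Proof. simpl; now rewrite andb_true_iff, Nat.ltb_lt, forallb_forall. Qed.

Lemma interp_data f vs : f < 20 -> interp f vs = Fun f vs.
Proof. intro L; do 20 (destruct f as [|f]; [reflexivity|]); lia. Qed.

Lemma ev_data a t : data t = true -> ev term interp a t = subst a t.
Proof.
  induction t as [y|f ts IH] using term_ind'; [reflexivity|].
  rewrite data_Fun; intros [L Dts]; simpl; rewrite interp_data by exact L.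
  f_equal; apply map_ext_in; intros t It; apply IH; auto.
Qed.

Lemma data_subterm g ts t : data t = true -> In (Fun g ts) (subterms t) -> g < 20.
Proof.
  induction t as [y|f us IH] using term_ind'.
  - simpl; intros _ [E|[]]; discriminate.
  - rewrite data_Fun; intros [L D] [E|J]; [injection E as -> ->; exact L|].
    apply in_flat_map in J as (u & Iu & J); apply (IH u Iu); auto.
Qed.

Lemma data_c : data c = true.
Proof. unfold ground in ground_c; now rewrite !andb_true_iff in ground_c. Qed.

Lemma data_x : data x = true.
Proof. unfold ground in ground_x; now rewrite !andb_true_iff in ground_x. Qed.

Lemma machine_data l r : In (l, r) (machine c x) -> data l = true /\ data r = true.
Proof.
  cbn [machine eval_rules init_rule In]; intro I.
  repeat (destruct I as [I|I]; [injection I as <- <-|]); try destruct I; cbn;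
    rewrite ?data_c, ?data_x; auto.
Qed.

Theorem search_terminates : (forall n, halts (start n)) ->
  forall t, Acc (rstep (search_trs c x)) t.
Proof.
  intro H.
  assert (bound : forall y, {n | run n (tInit y tZ) = None})
    by (intro y; apply constructive_indefinite_description, (init_halts H y 0)).
  (* The first component ranks [tRun] above [tClock] above the constructors. For a clock the second
     component is the time left; for a search with third argument [tGo] it is one more than the
     distance from the limit [w] to a halting time, and otherwise it is 0. *)
  set (m := fun f vs => match f, vs with
    | 20, [k; _] => (1, depth k)
    | 21, [y; w; b] =>
        (2, if term_eqb b tGo then S (proj1_sig (bound y) - depth w) else 0)
    | _, _ => (0, 0)
    end).
  assert (m_data : forall f vs, f < 20 -> m f vs = (0, 0)).
  { intros f vs L; do 20 (destruct f as [|f]; [reflexivity|]); lia. }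
  apply (labelled_termination (search_trs c x) term tZ interp
    _ (slexprod nat nat lt lt) m).
  - apply wf_slexprod; apply lt_wf.
  - apply wf_vars_ok, search_trs_wf.
  - intros l r a [I|[I|I]].
    + injection I as <- <-; reflexivity.
    + injection I as <- <-; reflexivity.
    + apply in_map_iff in I as ([l' r'] & E & I); injection E as <- <-.
      destruct (machine_data _ _ I) as [Dl Dr]; simpl.
      (* On constructor terms [ev] is substitution, so the two sides differ by one machine step and
         one tick of the clock. *)
      rewrite !ev_data by assumption.
      now rewrite (next_rule _ _ a I).
  - intros l r [I|[I|I]].
    + injection I as <- <-; do 2 eexists; split; [reflexivity|].
      intros a g ts J; simpl in J.
      repeat (destruct J as [J|J]; [try discriminate J; injection J as <- <-|]);
        try destruct J; simpl; try (left; lia).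
      (* If the new third argument has value [tGo], the machine still runs after [depth (a 1)]
         steps, so this limit is below the halting time and incrementing it lowers the distance.
         Otherwise the label drops to 0. *)
      right; destruct (run _ _) eqn:E; simpl; [|lia].
      destruct (bound (a 0)) as [n Hn]; simpl.
      enough (depth (a 1) < n) by lia; apply Nat.nle_gt; intro L.
      now rewrite (run_None_mono _ _ _ L Hn) in E.
    + injection I as <- <-; do 2 eexists; split; [reflexivity|].
      intros a g ts J; simpl in J.
      repeat (destruct J as [J|J]; [try discriminate J; injection J as <- <-|]);
        try destruct J; simpl; left; lia.
    + apply in_map_iff in I as ([l' r'] & E & I); injection E as <- <-.
      destruct (machine_data _ _ I) as [Dl Dr].
      do 2 eexists; split; [reflexivity|]; intros a g ts [J|J].
      * injection J as <- <-; simpl; right; lia.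
      * simpl in J; destruct J as [J|J]; [discriminate|].
        rewrite app_nil_r in J; rewrite m_data by exact (data_subterm _ _ _ Dr J).
        simpl; left; lia.
Qed.

(** * Perpetual reduction when a search fails *)

Lemma data_subst s t :
  data (subst s t) = true <->
  data t = true /\ forall y, In y (vars t) -> data (s y) = true.
Proof.
  induction t as [y|f ts IH] using term_ind'.
  - simpl; split; [intro D; split; [reflexivity|now intros ? [<-|[]]]|].
    intros [_ D]; auto.
  - simpl subst; rewrite !data_Fun; simpl vars; split.
    + intros [L D]; split; [split; [exact L|]|].
      * intros t It; apply (IH t It), D, in_map, It.
      * intros y Iy; apply in_flat_map in Iy as (t & It & Iy).
        revert y Iy; apply (IH t It), D, in_map, It.
    + intros [[L D] Dy]; split; [exact L|].
      intros u Iu; apply in_map_iff in Iu as (t & <- & It); apply (IH t It).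
      split; [auto|]; intros y Iy; apply Dy, in_flat_map; eauto.
Qed.

(** Every left-hand side has [tRun] or [tClock] at its root. *)
Lemma data_normal t u : data t = true -> ~ step (search_trs c x) t u.
Proof.
  intros D S; induction S as [l r s I|f pre t t' post S IH].
  - apply data_subst in D as [D _].
    destruct I as [I|[I|I]]; [injection I as <- <-; discriminate D..|].
    apply in_map_iff in I as (p & E & _); injection E as <- <-; discriminate D.
  - apply data_Fun in D as [_ D]; apply IH, D, in_elt.
Qed.

Lemma step_inv R t u : step R t u ->
  (exists l r s, In (l, r) (trs_rules R) /\ subst s l = t /\ subst s r = u) \/
  (exists f ts us, Fun f ts = t /\ Fun f us = u /\ args_step R us ts).
Proof.
  intros [l r s I|f pre v v' post S].
  - left; now exists l, r, s.
  - right; do 3 eexists; split; [reflexivity|split; [reflexivity|]].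
    now exists pre, v, v', post.
Qed.

Lemma data_args_step ts us : (forall t, In t ts -> data t = true) ->
  ~ args_step (search_trs c x) us ts.
Proof.
  intros D (pre & t & t' & post & -> & _ & S).
  apply (data_normal t t' (D t (in_elt _ _ _)) S).
Qed.

Lemma data_num n : data (num n) = true.
Proof. induction n as [|n IH]; simpl; [|rewrite IH]; reflexivity. Qed.

(** An invariant of all reductions from a failing search, not just of one infinite reduction: this
    is what refutes weak normalization. *)
Inductive perpetual (y : nat) : term -> Prop :=
| perpetual_go w : perpetual y (tRun (num y) (num w) tGo)
| perpetual_clock w k t : data t = true -> ~ halts t ->
    perpetual y (tRun (num y) (num w) (tClock (num k) t)).

Lemma machine_var0 l r : In (l, r) (machine c x) -> ~ In 0 (vars l).
Proof.
  cbn [machine eval_rules init_rule In]; intro I.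
  repeat (destruct I as [I|I]; [injection I as <- <-; simpl; lia|]); destruct I.
Qed.

Lemma clocked_step k l r s : In (l, r) (machine c x) ->
  step (search_trs c x) (tClock (tS k) (subst s l)) (tClock k (subst s r)).
Proof.
  intro I; set (s' := fun i => if i =? 0 then k else s i).
  assert (E : forall y, In y (vars l) -> s y = s' y).
  { intros [|y] Iy; [destruct (machine_var0 l r I Iy)|reflexivity]. }
  rewrite (subst_ext_vars s s' l E).
  rewrite (subst_ext_vars s s' r) by (intros y Iy; apply E, (machine_vars_ok l r I y Iy)).
  apply (step_root (search_trs c x) (tClock (tS (V 0)) l) (tClock (V 0) r) s').
  right; right; exact (in_map clocked _ _ I).
Qed.

Lemma perpetual_progress y t : perpetual y t -> exists u, step (search_trs c x) t u.
Proof.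
  intros [w|w k s D N].
  - eexists; apply (step_root (search_trs c x) (tRun (V 0) (V 1) tGo)
      (tRun (V 0) (tS (V 1)) (tClock (V 1) (tInit (V 0) tZ)))
      (fun i => if i =? 0 then num y else num w)); left; reflexivity.
  - enough (exists b, step (search_trs c x) (tClock (num k) s) b) as [b S].
    { eexists; exact (step_ctx _ 21 [num y; num w] _ b [] S). }
    destruct k as [|k].
    + exists tGo; apply (step_root (search_trs c x) (tClock tZ (V 0)) tGo (fun _ => s));
        simpl; auto.
    + destruct (next s) as [s'|] eqn:E; [|destruct N; now apply next_halts].
      apply next_sound in E as (l & r & a & I & <- & <-).
      exists (tClock (num k) (subst a r)); now apply clocked_step.
Qed.

Lemma reaches_halts t u : reaches t u -> halts t -> halts u.
Proof.
  intros [n En] [k Ek]; exists k.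
  apply (run_None_mono k (n + k)) in Ek; [|lia]; now rewrite run_add, En in Ek.
Qed.

(** All other arguments being normal constructor terms, the only redex is the root when the third
    argument is [tGo], and the clock otherwise. *)
Lemma perpetual_step y t u : ~ halts (start y) ->
  perpetual y t -> step (search_trs c x) t u -> perpetual y u.
Proof.
  intros Ny P S; apply step_inv in S; destruct P as [w|w k t D N].
  - destruct S as [(l & r & s & I & E & <-)|(f & ts & us & E & <- & S)].
    + destruct I as [I|[I|I]].
      * injection I as <- <-; simpl in E; injection E as E0 E1; simpl.
        rewrite E0, E1; apply (perpetual_clock y (S w)).
        -- simpl; now rewrite data_num.
        -- intro Hi; apply Ny; replace y with (y + 0) by lia.
           exact (reaches_halts _ _ (init_num y 0) Hi).
      * injection I as <- <-; discriminate E.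
      * apply in_map_iff in I as (p & Ep & _); injection Ep as <- <-; discriminate E.
    + exfalso; injection E as -> ->; revert S; apply data_args_step.
      intros t [<-|[<-|[<-|[]]]]; auto using data_num.
  - destruct S as [(l & r & s & I & E & <-)|(f & ts & us & E & <- & S)].
    + exfalso; destruct I as [I|[I|I]].
      * injection I as <- <-; discriminate E.
      * injection I as <- <-; discriminate E.
      * apply in_map_iff in I as (p & Ep & _); injection Ep as <- <-; discriminate E.
    + injection E as -> ->; destruct S as (pre & a & b & post & E & -> & S).
      (* The length of [pre] tells which argument is rewritten; only the third can be. *)
      destruct pre as [|p0 [|p1 [|p2 pre]]]; injection E as E.
      * subst; destruct (data_normal _ _ (data_num _) S).
      * subst; destruct (data_normal _ _ (data_num _) S).
      * subst; simpl; apply step_inv in S as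
          [(l & r & s & I & E & <-)|(f & ts & us & E & <- & S)].
        -- destruct I as [I|[I|I]].
           ++ injection I as <- <-; discriminate E.
           ++ injection I as <- <-; apply perpetual_go.
           ++ apply in_map_iff in I as ([l' r'] & Ep & I); injection Ep as <- <-.
              simpl in E; injection E as Ek Et; destruct k as [|k]; [discriminate Ek|].
              injection Ek as Ek; simpl; rewrite Ek.
              apply perpetual_clock.
              ** rewrite <- Et in D; apply data_subst in D as [_ D].
                 apply data_subst; split; [apply (machine_data _ _ I)|].
                 intros z Iz; apply D, (machine_vars_ok _ _ I z Iz).
              ** intro Hr; apply N; rewrite <- Et; apply halts_reaches with (2 := Hr).
                 exists 1; simpl; now rewrite (next_rule _ _ s I).
        -- exfalso; injection E as -> ->; revert S; apply data_args_step.
           intros u [<-|[<-|[]]]; auto using data_num.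
      * destruct pre; discriminate.
Qed.

Theorem search_not_WN y : ~ halts (start y) ->
  ~ WN_on (search_trs c x) (tRun (num y) tZ tGo).
Proof.
  intros Ny (s & S & NF).
  assert (P : perpetual y s).
  { clear NF; apply clos_rt_rtn1 in S; induction S as [|u v Suv _ IH].
    - exact (perpetual_go y 0).
    - exact (perpetual_step y u v Ny IH Suv). }
  exact (NF (perpetual_progress y s P)).
Qed.
End Machine.

(** * Hardness for Pi_2 *)

Lemma ground_iff t :
  ground t = true <-> overb sgn t = true /\ data t = true /\ vars t = [].
Proof. unfold ground; rewrite !andb_true_iff, is_nil_true; tauto. Qed.

Lemma ground_Fun f ts :
  (f <? 20) && existsb (fun p => (fst p =? f) && (snd p =? length ts)) sgn = true ->
  (forall t, In t ts -> ground t = true) -> ground (Fun f ts) = true.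
Proof.
  rewrite andb_true_iff; intros [L I] G; apply ground_iff.
  cbn [overb data vars]; rewrite L, I, !andb_true_l, !forallb_forall.
  repeat split; try (intros t It; now apply ground_iff, G).
  clear I; induction ts as [|t ts IH]; [reflexivity|]; simpl.
  rewrite (proj2 (proj2 (proj1 (ground_iff t) (G t (or_introl eq_refl))))).
  apply IH; intros; apply G; simpl; auto.
Qed.

Lemma ground_num n : ground (num n) = true.
Proof.
  induction n; cbn [num]; apply ground_Fun; try reflexivity; simpl; intuition congruence.
Qed.

Lemma ground_tlist ts : (forall t, In t ts -> ground t = true) ->
  ground (tlist ts) = true.
Proof.
  induction ts as [|t ts IH]; intro G; cbn [tlist fold_right]; apply ground_Fun;
    try reflexivity; [intros ? []|].
  intros u [<-|[<-|[]]]; [apply G; simpl; auto|apply IH; intros; apply G; simpl; auto].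
Qed.

Lemma ground_code : forall p, ground (code p) = true.
Proof.
  fix IH 1; intros [| |i|f gs|f g|f]; cbn [code]; (apply ground_Fun; [reflexivity|]).
  - intros ? [].
  - intros ? [].
  - intros ? [<-|[]]; apply ground_num.
  - intros ? [<-|[<-|[]]]; [apply IH|]; apply ground_tlist.
    induction gs as [|g gs IHgs]; intros t [].
    + rewrite <- H; apply IH.
    + now apply IHgs.
  - intros ? [<-|[<-|[]]]; apply IH.
  - intros ? [<-|[]]; apply IH.
Qed.

Lemma Comp_num {A} `{Enc A} (n : A -> nat) : Comp n -> Comp (fun a => num (n a)).
Proof.
  intro Cn; apply Comp_ext with
    (f := fun a => nat_rect (fun _ => term) tZ (fun _ t => tS t) (n a)).
  - intro a; induction (n a); simpl; congruence.
  - apply (Comp_nat_rect n (fun _ => tZ) (fun _ _ t => tS t)); comp.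
    apply Comp_Fun; comp.
Qed.

(** The program is fixed; the input enters only through the numeral in the starting rule. *)
Lemma search_trs_computable c : computable (fun n => enc_trs (search_trs c (num n))).
Proof.
  assert (C : Comp (fun n : nat => (trs_sig (search_trs c (num n)),
                                    trs_rules (search_trs c (num n))))).
  { unfold search_trs, machine, init_rule, clocked; cbn [trs_sig trs_rules map fst snd].
    comp.
    apply Comp_Fun; comp; apply Comp_Fun; comp; apply Comp_Fun; comp.
    apply Comp_Fun; comp; apply Comp_num; comp. }
  destruct C as (g & [e He] & Hg); exists e; intro n.
  rewrite enc_trs_prod, <- Hg; apply (He [n]).
Qed.

Lemma start_halts p (B : list nat -> Prop) y n :
  (forall v, (B v -> eval p v 0) /\ (~ B v -> eval p v 1)) ->
  halts (code (cMu p)) (num n) (start (code (cMu p)) (num n) y) <->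
  exists z, B [z; y; n].
Proof.
  intro Dp; pose proof (ground_code (cMu p)) as Gc; pose proof (ground_num n) as Gx.
  split.
  - intros [k Hk]; apply NNPP; intro N.
    apply (mu_diverges _ _ Gc Gx p [y; n]) with (2 := Hk).
    intro m; apply Dp; eauto.
  - intros [z Hz].
    (* [cMu] returns the first zero, so a least witness is extracted. *)
    assert (Least : exists m, B [m; y; n] /\ forall j, j < m -> ~ B [j; y; n]).
    { revert Hz; induction z as [z IH] using lt_wf_ind; intro Hz.
      destruct (classic (exists j, j < z /\ B [j; y; n])) as [(j & L & Hj)|N]; [eauto|].
      exists z; split; [exact Hz|]; intros j L Hj; apply N; eauto. }
    destruct Least as (m & Hm & Hlt).
    apply halts_reaches with (tRet (num m) kHalt); [|now apply halts_final].
    apply (simulate _ _ Gc Gx (cMu p) [y; n] m).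
    apply ev_mu; [now apply Dp|]; intros j L; exists 0; apply Dp; auto.
Qed.

(** One reduction serves both properties: its systems are either terminating on all terms or not
    even weakly normalizing, so any [P] between these two extremes is covered. *)
Lemma Pi2_hard (P : trs -> term -> Prop) :
  (forall R t, Acc (rstep R) t -> P R t) ->
  (forall R t, vars_ok (trs_rules R) -> P R t -> WN_on R t) ->
  forall B, in_Pi 2 B -> many_one_reducible B
    (fun n => exists R, wf_trs R /\ enc_trs R = n /\
                forall t, term_over (trs_sig R) t -> P R t).
Proof.
  intros HAcc HWN B (B1 & (B0 & [p Hp] & HB1) & HB).
  set (c := code (cMu p)).
  assert (Gc : ground c = true) by apply ground_code.
  exists (fun n => enc_trs (search_trs c (num n))); split;
    [apply search_trs_computable|].
  intro n; pose proof (ground_num n) as Gn.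
  assert (W : wf_trs (search_trs c (num n))) by now apply search_trs_wf.
  assert (Bn : B n <-> forall y, halts c (num n) (start c (num n) y)).
  { rewrite (HB [n]); split; intros H y; specialize (H y).
    - apply (start_halts p B0 y n Hp), HB1, H.
    - apply HB1, (start_halts p B0 y n Hp), H. }
  rewrite Bn; split.
  - intro H; exists (search_trs c (num n)); split; [exact W|split; [reflexivity|]].
    intros t _; apply HAcc; now apply search_terminates.
  - intros (R & _ & E & H) y; apply enc_trs_inj in E; subst R.
    apply NNPP; intro Ny.
    apply (search_not_WN c (num n) Gc Gn y Ny), HWN, H; [now apply wf_vars_ok|].
    apply overb_spec; change (overb sgn (tRun (num y) tZ tGo) = true); cbn [overb forallb].
    now rewrite (proj1 (proj1 (ground_iff _) (ground_num y))).
Qed.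

Theorem theorem2 : Pi_complete 2 SN_codes /\ Pi_complete 2 WN_codes.
Proof.
  split; (split; [|apply Pi2_hard]).
  - apply SN_codes_in_Pi2.
  - apply Acc_SN_on.
  - intros R t _ SN; now apply Acc_WN_on, SN_on_Acc.
  - apply WN_codes_in_Pi2.
  - apply Acc_WN_on.
  - auto.
Qed.
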